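(* Let $n\ge3$, $a\in\mathbb{R}\setminus\{0\}$ and $\hat m_1,\hat m_2,f\in\mathbb{R}$. The spherical mechanical billiard system defined on $\mathcal{S}^n$ by the spherical Lagrange problem, with any finite combination (finite union) of spherical confocal quadrics with foci at the two Kepler centers $Z_1,Z_2$ as reflection walls, is integrable. As subcases, the billiard systems with such walls defined on $\mathcal{S}^n$ by the spherical two-center problem ($f=0$), by the spherical Kepler problem ($\hat m_1=f=0$ or $\hat m_2=f=0$; one of the foci is then the Kepler center), and by the spherical Hooke problem ($\hat m_1=\hat m_2=0$; the quadrics are then centered at the Hooke center) are integrable. The first integrals are $$E_{sph}=\tfrac12\sum_{i=1}^{n+1}q_i'^2-\frac{\hat m_1}{\tan\theta_{Z_1}}-\frac{\hat m_2}{\tan\theta_{Z_2}}-f\tan^2\theta_{Z_0},$$ $$\hat E_{sp}=\tfrac12\Big(\frac{(q_{n+1}q_1'-q_1q_{n+1}')^2}{1+a^2}+\sum_{i=2}^n(q_{n+1}q_i'-q_iq_{n+1}')^2\Big)-f\Big(\frac{q_1^2}{(1+a^2)q_{n+1}^2}+\sum_{i=2}^n\frac{q_i^2}{q_{n+1}^2}\Big)+\frac{m_1q_{n+1}}{\sqrt{\frac{(q_1+aq_{n+1})^2}{1+a^2}+\sum_{i=2}^nq_i^2}}+\frac{m_2q_{n+1}}{\sqrt{\frac{(q_1-aq_{n+1})^2}{1+a^2}+\sum_{i=2}^nq_i^2}},$$ $$\hat C_k=\sum_{2\le i<j\le k}(q_iq_j'-q_i'q_j)^2,\qquad 3\le k\le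 n,$$ where $m_i=\hat m_i/\sqrt{1+a^2}$.
   Context: A natural mechanical system $(M,g,U)$ is a Riemannian manifold $(M,g)$ with a force function $U$ (smooth outside a singular set); its motions satisfy $\nabla_{q'}q'=\mathrm{grad}_g U(q)$, where $'$ is the time derivative. A first integral is a function on $TM$ constant along motions. Poisson brackets of functions on $TM$ are those obtained from the canonical bracket of $T^*M$ via $v\mapsto g(v,\cdot)$. The elastic reflection at a point $q$ of a hypersurface $\mathcal{B}$ sends $v=v_t+v_n$ to $v'=v_t-v_n$ ($v_t$ tangent, $v_n$ $g$-normal to $\mathcal{B}$). The billiard system $(M,g,U,\mathcal{B})$, $\dim M=N$, is integrable if there are $N$ functionally independent first integrals of $(M,g,U)$ (differentials linearly independent on an open dense set), pairwise in involution, each satisfying $F(q,v)=F(q,v')$ for all reflections at $\mathcal{B}$. For a finite union of quadrics, reflections are considered at every point (outside singularities of $U$) of each quadric with respect to the tangent space of that quadric. $\mathcal{S}^n\subset\mathbb{R}^{n+1}$ is the unit sphere with the round metric, coordinates $(q_1,\dots,q_{n+1})$. Kepler centers $Z_1=(\frac{a}{\sqrt{1+a^2}},0,\dots,0,-\frac1{\sqrt{1+a^2}})$, $Z_2=(-\frac{a}{\sqrt{1+a^2}},0,\dots,0,-\frac1{\sqrt{1+a^2}})$ (together with their antipodal points), Hooke center $Z_0=(0,\dots,0,-1)$ (and its antipode). The spherical Lagrange problem on $\mathcal{S}^n$ has force function $U(q)=\hat m_1\cot\theta_{Z_1}+\hat m_2\cot\theta_{Z_2}+f\tan^2\theta_{Z_0}$,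 where $\theta_Z=\angle qOZ\in[0,\pi]$; it is singular at the Kepler centers and their antipodes and, if $f\ne0$, on the equator $\{q_{n+1}=0\}$. A spherical confocal quadric is a non-degenerate quadric on $\mathcal{S}^n$ which is the locus of points for which $\theta_{Z_1}+\theta_{Z_2}$ is a constant $c$, $d<c<2\pi-d$, $c\ne\pi$ (spheroid), or $|\theta_{Z_1}-\theta_{Z_2}|$ is a constant $c$, $0<c<d$ (circular hyperboloid of two sheets), where $d$ is the spherical distance between $Z_1$ and $Z_2$. *)

(* Defs.v *)
(* MathComp-Analysis; R : realType throughout. *)
From HB Require Import structures.
From mathcomp Require Import all_boot all_order all_algebra.
From mathcomp Require Import all_classical all_reals all_analysis.

Set Implicit Arguments.
Unset Strict Implicit.
Unset Printing Implicit Defensive.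

Import Order.TTheory GRing.Theory Num.Theory.
Import numFieldNormedType.Exports.
Local Open Scope classical_set_scope.
Local Open Scope ring_scope.

(* The sphere S^n sits in 'rV[R]_n.+1.  The library norm `|x| on row vectors
   is the sup norm: it is used only for the topology and for derivatives, and
   Euclidean geometry goes through dot and enorm. *)

Section EuclideanSpace.
Context {R : realType} {n : nat}.
Notation V := 'rV[R]_n.+1.

(* 1-based coordinate, for 1 <= i <= n.+1. *)
Definition co (q : V) (i : nat) : R := q ord0 (inord i.-1).

Definition dot (u v : V) : R := \sum_(i < n.+1) u ord0 i * v ord0 i.

Definition enorm (u : V) : R := Num.sqrt (dot u u).

(* Only the direction of u and v matters, so angle ^~ Z is defined on the whole
   ambient space minus the origin and extends the function theta_Z. *)
Definition angle (u v : V) : R := acos (dot u v / (enorm u * enorm v)).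

Definition sphere : set V := [set q | dot q q = 1].

Definition tangent (q w : V) : Prop := dot q w = 0.

End EuclideanSpace.

Definition cot {R : realType} (t : R) : R := cos t / sin t.

Section Smoothness.
Context {R : realType} {W : normedModType R}.

(* On a finite-dimensional W and an open set A this is the usual class C^k:
   f is differentiable and all its directional derivatives are C^(k-1). *)
Fixpoint Ck (k : nat) (A : set W) (f : W -> R) : Prop :=
  match k with
  | 0 => forall x, A x -> {for x, continuous f}
  | k'.+1 => (forall x, A x -> differentiable f x) /\
             (forall v : W, Ck k' A (fun x => 'D_v f x))
  end.

(* A function on a submanifold P of W is represented by a function on W that is
   smooth on a neighbourhood of P. *)
Definition smooth_near (P : set W) (f : W -> R) : Prop :=
  exists A : set W, [/\ open A, P `<=` A & forall k, Ck k A f].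

End Smoothness.

Section MechanicalSystems.
Context {R : realType} {n : nat}.
Notation V := 'rV[R]_n.+1.

(* A natural mechanical system on the round sphere S^n. *)
Record mech_system := MechSystem { force : V -> R; singular : set V }.

Implicit Types (S : mech_system) (F G : V * V -> R).

Definition regular S : set V := sphere `\` singular S.

Definition phase_space S : set (V * V) :=
  [set x | regular S x.1 /\ tangent x.1 x.2].

(* g = grad_g f at q, for the round metric. *)
Definition is_grad (f : V -> R) (q g : V) : Prop :=
  tangent q g /\ forall w : V, tangent q w -> dot g w = 'd f q w.

(* Orthogonal projection of w onto the tangent space at q. *)
Definition tproj (q w : V) : V := w - dot q w *: q.

(* The Levi-Civita derivative of the velocity along a curve on the sphere is the
   tangential part of its acceleration in the ambient space. *)
Definition is_motion S (t0 t1 : R) (q : R -> V) : Prop :=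
  forall t, t0 < t < t1 ->
    [/\ regular S (q t), derivable q t 1, derivable (derive1 q) t 1
      & is_grad (force S) (q t) (tproj (q t) (derive1 (derive1 q) t))].

Definition first_integral S F : Prop :=
  forall (t0 t1 : R) (q : R -> V), is_motion S t0 t1 q ->
  forall s t, t0 < s < t1 -> t0 < t < t1 ->
    F (q s, derive1 q s) = F (q t, derive1 q t).

(* The tangent space of TS^n = {(q, v) | |q|^2 = 1, q.v = 0} at x = (q, v). *)
Definition tangent2 (x w : V * V) : Prop :=
  dot x.1 w.1 = 0 /\ dot x.2 w.1 + dot x.1 w.2 = 0.

(* The canonical form of T*S^n, transported to TS^n by v |-> g(v, .), is the
   restriction of the form sum_i dq_i /\ dv_i of the ambient space. *)
Definition omega (w w' : V * V) : R := dot w.1 w'.2 - dot w.2 w'.1.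

Definition is_hamiltonian_vector F (x X : V * V) : Prop :=
  tangent2 x X /\ forall w, tangent2 x w -> omega X w = 'd F x w.

(* At a point x of TS^n the form omega is nondegenerate on tangent2 x, so that
   the Hamiltonian vector exists and is unique. *)
Definition hamiltonian_vector F (x : V * V) : V * V :=
  xget 0 [set X | is_hamiltonian_vector F x X].

Definition poisson_bracket F G (x : V * V) : R :=
  omega (hamiltonian_vector F x) (hamiltonian_vector G x).

Definition independent_at (I : finType) (F : I -> V * V -> R) (x : V * V) :=
  forall c : I -> R,
    (forall w, tangent2 x w -> \sum_i c i * 'd (F i) x w = 0) ->
    forall i, c i = 0.

(* O `&` phase_space S is an open dense subset of the phase space. *)
Definition functionally_independent S (I : finType) (F : I -> V * V -> R) :=
  exists O : set (V * V),
    [/\ open O, phase_space S `<=` closure (O `&` phase_space S)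
      & forall x, O x -> phase_space S x -> independent_at F x].

(* Velocities at q of the curves drawn on B. *)
Definition wall_tangent (B : set V) (q w : V) : Prop :=
  exists c : R -> V,
    [/\ c 0 = q, \forall t \near (0 : R), B (c t), derivable c 0 1
      & derive1 c 0 = w].

Definition reflection (B : set V) (q v v' : V) : Prop :=
  exists vt vn : V,
    [/\ wall_tangent B q vt,
        tangent q vn /\ (forall w, wall_tangent B q w -> dot vn w = 0),
        v = vt + vn & v' = vt - vn].

Definition reflection_invariant S (B : set V) F : Prop :=
  forall q v v', B q -> phase_space S (q, v) -> reflection B q v v' ->
    F (q, v) = F (q, v').

(* The billiard system in S with walls B i is integrable, with the
   n = dim S^n first integrals F i. *)
Definition integrable_by S (m : nat) (B : 'I_m -> set V)
    (F : 'I_n -> V * V -> R) : Prop :=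
  [/\ smooth_near (regular S) (force S),
      forall i, smooth_near (phase_space S) (F i) /\ first_integral S (F i),
      functionally_independent S F,
      forall i j x, phase_space S x -> poisson_bracket (F i) (F j) x = 0
    & forall i k, reflection_invariant S (B k) (F i)].

Definition superpose S S' : mech_system :=
  MechSystem (fun q => force S q + force S' q) (singular S `|` singular S').

(* Without its force (zero mass, zero Hooke parameter) a center is not
   singular. *)
Definition kepler (Z : V) (hm : R) : mech_system :=
  MechSystem (fun q => hm * cot (angle q Z))
             [set q | hm <> 0 /\ (q = Z \/ q = - Z)].

Definition hooke (Z : V) (f : R) : mech_system :=
  MechSystem (fun q => f * tan (angle q Z) ^+ 2)
             [set q | f <> 0 /\ dot q Z = 0].

End MechanicalSystems.

Section LagrangeProblem.
Context {R : realType} (n : nat).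
Notation V := 'rV[R]_n.+1.

Definition kepler_center (a : R) : V :=
  \row_(j < n.+1) (if j == 0%N :> nat then a / Num.sqrt (1 + a ^+ 2)
                   else if j == n :> nat then - (Num.sqrt (1 + a ^+ 2))^-1
                   else 0).

Definition Z1 (a : R) : V := kepler_center a.
Definition Z2 (a : R) : V := kepler_center (- a).
Definition Z0 : V := \row_(j < n.+1) (if j == n :> nat then -1 else 0).

Definition two_center (a hm1 hm2 : R) : mech_system :=
  superpose (kepler (Z1 a) hm1) (kepler (Z2 a) hm2).

Definition lagrange_problem (a hm1 hm2 f : R) : mech_system :=
  superpose (two_center a hm1 hm2) (hooke Z0 f).

Definition spheroid (a c : R) : set V :=
  [set q | sphere q /\ angle q (Z1 a) + angle q (Z2 a) = c].

Definition hyperboloid (a c : R) : set V :=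
  [set q | sphere q /\ `|angle q (Z1 a) - angle q (Z2 a)| = c].

Definition spherical_confocal_quadric (a : R) (B : set V) : Prop :=
  let d := angle (Z1 a) (Z2 a) in
  exists c : R,
    (d < c < 2 * pi - d /\ c <> pi /\ B = spheroid a c) \/
    (0 < c < d /\ B = hyperboloid a c).

(* B is symmetric under the geodesic symmetry of the sphere at Z. *)
Definition centered_at (Z : V) (B : set V) : Prop :=
  forall q, B q -> B ((2 * dot q Z) *: Z - q).

Definition E_sph (a hm1 hm2 f : R) (x : V * V) : R :=
  let q := x.1 in let q' := x.2 in
  2^-1 * (\sum_(1 <= i < n.+2) co q' i ^+ 2)
  - hm1 / tan (angle q (Z1 a)) - hm2 / tan (angle q (Z2 a))
  - f * tan (angle q Z0) ^+ 2.

Definition E_sp (a hm1 hm2 f : R) (x : V * V) : R :=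
  let q := co x.1 in let q' := co x.2 in
  let m1 := hm1 / Num.sqrt (1 + a ^+ 2) in
  let m2 := hm2 / Num.sqrt (1 + a ^+ 2) in
  let N := n.+1 in
  2^-1 * ((q N * q' 1%N - q 1%N * q' N) ^+ 2 / (1 + a ^+ 2)
          + \sum_(2 <= i < n.+1) (q N * q' i - q i * q' N) ^+ 2)
  - f * (q 1%N ^+ 2 / ((1 + a ^+ 2) * q N ^+ 2)
         + \sum_(2 <= i < n.+1) q i ^+ 2 / q N ^+ 2)
  + m1 * q N / Num.sqrt ((q 1%N + a * q N) ^+ 2 / (1 + a ^+ 2)
                         + \sum_(2 <= i < n.+1) q i ^+ 2)
  + m2 * q N / Num.sqrt ((q 1%N - a * q N) ^+ 2 / (1 + a ^+ 2)
                         + \sum_(2 <= i < n.+1) q i ^+ 2).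

Definition C_hat (k : nat) (x : V * V) : R :=
  let q := co x.1 in let q' := co x.2 in
  \sum_(2 <= j < k.+1) \sum_(2 <= i < j) (q i * q' j - q' i * q j) ^+ 2.

(* The n functions E_sph, E_sp, C_hat 3, ..., C_hat n. *)
Definition lagrange_integrals (a hm1 hm2 f : R) (i : 'I_n) : V * V -> R :=
  match val i with
  | 0 => E_sph a hm1 hm2 f
  | 1 => E_sp a hm1 hm2 f
  | k.+2 => C_hat k.+3
  end.

End LagrangeProblem.

(* Main.v *)
(* The Hamiltonian vector field of C_hat k rotates the coordinates 2, ..., k of q
   and v simultaneously, and every integral depends on these coordinates only
   through rotation invariants; this gives all brackets with C_hat k.  The bracket
   of E_sph and E_sp vanishes term by term: each center contributes a potential to
   E_sph and a conjugate one to E_sp, and the rotations in the (q_i, q_(n+1)) planes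
   exchange their derivatives.  As motions are integral curves of the field of
   E_sph, involution with E_sph is conservation.

   Along the fibres the differentials do not see the potentials, so independence
   reduces to a polynomial condition in (q, v); it is dense because it holds at one
   point, hence at generic points of any line through that point.

   With C = cos c, cos theta_Z1 = x and cos theta_Z2 = y, the product
   (cos (theta_Z1 + theta_Z2) - C) (cos (theta_Z1 - theta_Z2) - C)
   is the quadratic form x^2 + y^2 - 2 C x y - (1 - C^2), so that spheroids and
   hyperboloids are traces on the sphere of the confocal diagonal cones.  Rotations
   preserving the cone provide enough curves on the wall to force a normal vector to
   be proportional to the gradient of the form, and the tangential and normal parts
   of a velocity are then orthogonal for the kinetic part of E_sp. *)

(* The second energy comes from central projection. In the chart x_i = q_i / q_(n+1), [angmom i q v]
   is q_(n+1)^2 times the velocity of x_i. With x_1 divided by sqrt (1 + a^2), [kinetic_sp] becomes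
   a Euclidean kinetic energy after a change of time, and [kconj] and [hconj] are, up to sign and
   constants, Newton and Hooke potentials. The proof does not project: it uses the infinitesimal
   trace of this fact, [kepler_duality] and [hooke_duality].

   Differentials are taken in the ambient space, while the forces are given through angles. Angles
   do not change when q is scaled, so the closed formulas [kforce] and [hforce] hold for all q <> 0
   and can be differentiated instead. A center of zero weight is not singular; conditions at a
   center are therefore guarded by its weight being nonzero, and the subcases become literal
   instances of the Lagrange problem.

   The range of c keeps cos c away from 1, - 1 and [cosfoci]. This makes every coefficient of the
   cone nonzero, hence also its gradient at points of the wall. *)
Require Import Defs.
From HB Require Import structures.
From mathcomp Require Import all_boot all_order all_algebra.
From mathcomp Require Import all_classical all_reals all_analysis.
From mathcomp Require Import ring lra.
Import Order.TTheory GRing.Theory Num.Theory.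
Import numFieldNormedType.Exports.
Local Open Scope classical_set_scope.
Local Open Scope ring_scope.
Set Implicit Arguments.
Unset Strict Implicit.
Unset Printing Implicit Defensive.

(** * Differential calculus *)

Section Differentials.
Context {R : realType} {W : normedModType R}.
Implicit Types (f g : W -> R) (x : W).

(** As g - f vanishes near x, it is its own little-o remainder and has differential 0; adding it to
    f transfers the differential. *)
Lemma near_is_diff f g df x :
  (\forall y \near x, f y = g y) -> is_diff x f df -> is_diff x g df.
Proof.
move=> fg dfx; pose h := g - f.
have h0 : h \o shift x = cst (h x) + (\0 : W -> R) +o_ 0 id.
  have hx0 : h x = 0 by rewrite /h !fctE (nbhs_singleton fg) subrr.
  rewrite hx0 -[X in _ = X + _]/(fun=> 0 + 0).
  apply/eqaddoP => _/posnumP[e].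
  have : \forall y \near (0 : W), f (y + x) = g (y + x).
    by move: fg; rewrite (near_shift 0)/=; apply: filterS => y; rewrite subr0.
  apply: filterS => y fgy.
  rewrite /h !fctE/= fgy subrr add0r subrr normr0 mulr_ge0//.
have cst0 : continuous (\0 : W -> R) by move=> ?; exact: cst_continuous.
have du := diff_unique cst0 h0.
have hd : is_diff x h (\0).
  by apply: DiffDef => //; apply/diff_locallyP; rewrite du.
have -> : g = f + h by apply/funext => y; rewrite /h !fctE addrC subrK.
have [d e] := is_diffD dfx hd; split; first exact: d.
by rewrite e addr0.
Qed.

Lemma is_diff_ext f df dg x :
  is_diff x f df -> (forall w, df w = dg w) -> is_diff x f dg.
Proof. by move=> fd /funext <-. Qed.

Lemma is_diff_add f g df dg x : is_diff x f df -> is_diff x g dg ->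
  is_diff x (fun y => f y + g y) (fun w => df w + dg w).
Proof. exact: is_diffD. Qed.

Lemma is_diff_sub f g df dg x : is_diff x f df -> is_diff x g dg ->
  is_diff x (fun y => f y - g y) (fun w => df w - dg w).
Proof. exact: is_diffB. Qed.

Lemma is_diff_mul f g df dg x : is_diff x f df -> is_diff x g dg ->
  is_diff x (fun y => f y * g y) (fun w => f x * dg w + g x * df w).
Proof. exact: is_diffM. Qed.

Lemma is_diff_const (c : R) x : is_diff x (fun=> c) (fun=> 0).
Proof. exact: is_diff_cst. Qed.

Lemma is_diff_scale (c : R) f df x : is_diff x f df ->
  is_diff x (fun y => c * f y) (fun w => c * df w).
Proof. exact: is_diffZ. Qed.

Lemma is_diff_sqr f df x : is_diff x f df ->
  is_diff x (fun y => f y ^+ 2) (fun w => 2 * f x * df w).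
Proof.
move=> fd; apply: is_diff_ext (is_diff_mul fd fd) _ => w.
by rewrite mulr_natl mulr2n mulrDl.
Qed.

Lemma is_diff_comp1 (h : R -> R) f df (dh : R) x :
  is_diff x f df -> is_derive (f x) 1 h dh ->
  is_diff x (fun y => h (f y)) (fun w => dh * df w).
Proof.
move=> fd hd; have hd' : is_diff (f x) h ( *%R^~ dh).
  apply: DiffDef; first exact/derivable1_diffP.
  by rewrite deriv1E// derive1E derive_val; apply/funext.
by apply: is_diff_ext (is_diff_comp fd hd') _ => w /=; rewrite mulrC.
Qed.

Lemma is_diff_inv f df x : is_diff x f df -> f x != 0 ->
  is_diff x (fun y => (f y)^-1) (fun w => - (f x)^-2 * df w).
Proof.
move=> fd f0; apply: (@is_diff_comp1 (fun t => t^-1)).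
apply: DeriveDef; first exact: derivableV.
by rewrite deriveV ?derive_id//; exact: mulr1.
Qed.

Lemma is_diff_sqrt f df x : is_diff x f df -> 0 < f x ->
  is_diff x (fun y => Num.sqrt (f y))
    (fun w => (2 * Num.sqrt (f x))^-1 * df w).
Proof. by move=> fd f0; apply: is_diff_comp1 (is_derive1_sqrt f0). Qed.

Lemma is_diff_bigsum (I : Type) (r : seq I) (F dF : I -> W -> R) x :
  (forall i, is_diff x (F i) (dF i)) ->
  is_diff x (fun y => \sum_(i <- r) F i y) (fun w => \sum_(i <- r) dF i w).
Proof.
move=> Fd; elim: r => [|i r IH].
  by have := is_diff_const 0 x; congr is_diff_def; apply/funext => y;
    rewrite big_nil.
have := is_diff_add (Fd i) IH.
by congr is_diff_def; apply/funext => y; rewrite big_cons.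
Qed.

End Differentials.

(** * Closure properties of the classes C^k *)

Section Smooth.
Context {R : realType} {W : normedModType R}.
Implicit Types (f g : W -> R) (A : set W).

Lemma Ck_eq k A f g : open A -> (forall x, A x -> f x = g x) ->
  Ck k A f -> Ck k A g.
Proof.
elim: k f g => [|k IH] f g oA fg /=.
  move=> cf x Ax; have nfg : \forall y \near x, f y = g y.
    by apply: filterS (open_nbhs_nbhs (conj oA Ax)).
  have : f @ x --> f x by exact: cf.
  rewrite (fg x Ax) => cfx; suff : g @ x --> g x by []; apply: cvg_trans cfx.
  exact: near_eq_cvg nfg.
have nfg x : A x -> \forall y \near x, f y = g y.
  by move=> Ax; apply: filterS (open_nbhs_nbhs (conj oA Ax)).
move=> [df Df]; split=> [x Ax|v].
  by have [] := near_is_diff (nfg x Ax) (differentiableP (df x Ax)).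
by apply: (IH _ _ oA _ (Df v)) => x Ax; exact: near_eq_derive (nfg x Ax).
Qed.

Lemma CkS k A f : Ck k.+1 A f -> Ck k A f.
Proof.
elim: k f => [|k IH] f [df Df].
  by move=> x Ax; exact/differentiable_continuous/df.
by split=> // v; exact: IH (Df v).
Qed.

Lemma Ck_cst k A (c : R) : Ck k A (fun=> c).
Proof.
elim: k c => [|k IH] c /=; first by move=> x _; exact: cst_continuous.
split=> [x _|v]; first exact: differentiable_cst.
by have := IH 0; congr Ck; apply/funext => x; rewrite derive_cst.
Qed.

Lemma Ck_lin k A f : (forall x, is_diff x f f) -> Ck k A f.
Proof.
move=> df; case: k => [|k] /=.
  by move=> x _; apply: differentiable_continuous; have [] := df x.
split=> [x _|v]; first by have [] := df x.
have := Ck_cst k A (f v); congr Ck; apply/funext => x.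
by have [? e] := df x; rewrite deriveE// e.
Qed.

Lemma Ck_add k A f g : open A -> Ck k A f -> Ck k A g ->
  Ck k A (fun x => f x + g x).
Proof.
move=> oA; elim: k f g => [|k IH] f g /=.
  by move=> cf cg x Ax; apply: continuousD; [exact: cf|exact: cg].
move=> [df Df] [dg Dg]; split=> [x Ax|v].
  by apply: differentiableD; [exact: df|exact: dg].
apply: Ck_eq (IH _ _ (Df v) (Dg v)) => // x Ax.
by rewrite deriveD//; apply: diff_derivable; [exact: df|exact: dg].
Qed.

Lemma Ck_mul k A f g : open A -> Ck k A f -> Ck k A g ->
  Ck k A (fun x => f x * g x).
Proof.
move=> oA; elim: k f g => [|k IH] f g.
  by move=> cf cg x Ax; apply: continuousM; [exact: cf|exact: cg].
move=> Cf Cg; have [df Df] := Cf; have [dg Dg] := Cg; split=> [x Ax|v].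
  by apply: differentiableM; [exact: df|exact: dg].
apply: Ck_eq (Ck_add oA (IH _ _ (CkS Cf) (Dg v)) (IH _ _ (CkS Cg) (Df v))) => //.
move=> x Ax; rewrite deriveM//; apply: diff_derivable;
  [exact: df|exact: dg].
Qed.

Lemma Ck_opp k A f : open A -> Ck k A f -> Ck k A (fun x => - f x).
Proof.
move=> oA /(Ck_mul oA (Ck_cst k A (-1))); apply: Ck_eq => // x _.
by rewrite mulN1r.
Qed.

(** The derivative - (1/f)^2 f' is again expressed through 1/f, so the induction on k closes.
    [Ck_sqrt] works in the same way. *)
Lemma Ck_inv k A f : open A -> (forall x, A x -> f x != 0) -> Ck k A f ->
  Ck k A (fun x => (f x)^-1).
Proof.
move=> oA f0; elim: k => [|k IH].
  by move=> cf x Ax; apply: continuousV; [exact: f0|exact: cf].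
move=> Cf; have [df Df] := Cf; split=> [x Ax|v].
  by apply: differentiableV; [exact: df|exact: f0].
have Ci := IH (CkS Cf).
apply: Ck_eq (Ck_mul oA (Ck_opp oA (Ck_mul oA Ci Ci)) (Df v)) => // x Ax.
rewrite deriveV ?f0//; last exact/diff_derivable/df.
by rewrite expr2 invfM.
Qed.

Lemma Ck_sqrt k A f : open A -> (forall x, A x -> 0 < f x) -> Ck k A f ->
  Ck k A (fun x => Num.sqrt (f x)).
Proof.
move=> oA f0; elim: k => [|k IH].
  move=> cf x Ax; apply: (@continuous_comp _ _ _ f Num.sqrt); first exact: cf.
  exact: sqrt_continuous.
move=> Cf; have [df Df] := Cf.
have dS x : A x -> is_diff x (fun y => Num.sqrt (f y))
    (fun w => (2 * Num.sqrt (f x))^-1 * 'd f x w).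
  by move=> Ax; apply: is_diff_sqrt (f0 x Ax); exact/differentiableP/df.
split=> [x Ax|v]; first by have [] := dS x Ax.
have C2 := Ck_mul oA (Ck_cst k A 2) (IH (CkS Cf)).
have S0 x : A x -> 2 * Num.sqrt (f x) != 0.
  by move=> Ax; rewrite mulf_neq0// gt_eqF// sqrtr_gt0 f0.
apply: Ck_eq (Ck_mul oA (Ck_inv oA S0 C2) (Df v)) => // x Ax.
have [d e] := dS x Ax; rewrite [RHS]deriveE// e deriveE//; exact: df.
Qed.

Lemma Ck_sum k A (I : Type) (r : seq I) (F : I -> W -> R) : open A ->
  (forall i, Ck k A (F i)) -> Ck k A (fun x => \sum_(i <- r) F i x).
Proof.
move=> oA CF; elim: r => [|i r IH].
  by apply: Ck_eq (Ck_cst k A 0) => // x _; rewrite big_nil.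
by apply: Ck_eq (Ck_add oA (CF i) IH) => // x _; rewrite big_cons.
Qed.

End Smooth.

(** * Coordinates *)

Section Coordinates.
Context {R : realType} {n : nat}.
Notation V := 'rV[R]_n.+1.
Implicit Types (u v w q : V) (c : R).

(** The foci lie in the plane of e_1 and e_(n+1). [cdot n] is the scalar product of its orthogonal
    complement, and smaller k give the flag of rotation groups behind the [C_hat]. *)
Definition cdot (k : nat) u v : R := \sum_(2 <= i < k.+1) co u i * co v i.

Definition vec (g : nat -> R) : V := \row_(j < n.+1) g j.+1.

Lemma co_vec g i : (0 < i <= n.+1)%N -> co (vec g) i = g i.
Proof.
by case: i => // i /andP[_ lin]; rewrite /co mxE inordK.
Qed.

Lemma vec_co q : vec (co q) = q.
Proof.
by apply/rowP => j; rewrite mxE /co/=; congr (q _ _); apply/val_inj; rewrite /= inordK.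
Qed.

Lemma coP u v : (forall i, (0 < i <= n.+1)%N -> co u i = co v i) -> u = v.
Proof.
by move=> uv; rewrite -(vec_co u) -(vec_co v); apply/rowP => j; rewrite !mxE uv/=.
Qed.

Lemma coD u v i : co (u + v) i = co u i + co v i.
Proof. by rewrite /co mxE. Qed.
Lemma coN u i : co (- u) i = - co u i.
Proof. by rewrite /co mxE. Qed.
Lemma coB u v i : co (u - v) i = co u i - co v i.
Proof. by rewrite coD coN. Qed.
Lemma coZ c u i : co (c *: u) i = c * co u i.
Proof. by rewrite /co mxE. Qed.
Lemma co0 i : co (0 : V) i = 0.
Proof. by rewrite /co mxE. Qed.

Definition coE := (coB, coD, coN, coZ, co0).

Lemma dot_sum u v : dot u v = \sum_(1 <= i < n.+2) co u i * co v i.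
Proof.
rewrite big_add1/= big_mkord; apply: eq_bigr => i _.
by rewrite /co/=; congr (u _ _ * v _ _); apply/val_inj; rewrite /= inordK.
Qed.

Lemma dot_cdot u v : (0 < n)%N ->
  dot u v = co u 1 * co v 1 + cdot n u v + co u n.+1 * co v n.+1.
Proof.
by move=> n0; rewrite dot_sum big_ltn// big_nat_recr//= addrA.
Qed.

Lemma dotC u v : dot u v = dot v u.
Proof. by apply: eq_bigr => i _; rewrite mulrC. Qed.
Lemma dotDr u v w : dot u (v + w) = dot u v + dot u w.
Proof. by rewrite -big_split; apply: eq_bigr => i _ /=; rewrite mxE mulrDr. Qed.
Lemma dotDl u v w : dot (v + w) u = dot v u + dot w u.
Proof. by rewrite dotC dotDr !(dotC u). Qed.
Lemma dotNr u v : dot u (- v) = - dot u v.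
Proof. by rewrite -sumrN; apply: eq_bigr => i _ /=; rewrite mxE mulrN. Qed.
Lemma dotNl u v : dot (- v) u = - dot v u.
Proof. by rewrite dotC dotNr dotC. Qed.
Lemma dotZr c u v : dot u (c *: v) = c * dot u v.
Proof. by rewrite mulr_sumr; apply: eq_bigr => i _ /=; rewrite mxE mulrCA. Qed.
Lemma dotZl c u v : dot (c *: v) u = c * dot v u.
Proof. by rewrite dotC dotZr dotC. Qed.
Lemma dot0r u : dot u 0 = 0.
Proof. by apply: big1 => i _; rewrite mxE mulr0. Qed.
Lemma dot0l u : dot 0 u = 0.
Proof. by rewrite dotC dot0r. Qed.

Definition dotE := (dotDr, dotDl, dotNr, dotNl, dotZr, dotZl, dot0r, dot0l).

Lemma dot_ge0 u : 0 <= dot u u.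
Proof. by apply: sumr_ge0 => i _; rewrite -expr2 sqr_ge0. Qed.

Lemma dot_eq0 u : dot u u = 0 -> u = 0.
Proof.
move=> /eqP; rewrite psumr_eq0; last by move=> i _; rewrite -expr2 sqr_ge0.
move=> /allP u0; apply/rowP => j; rewrite mxE; apply/eqP.
by have := u0 j (mem_index_enum _); rewrite /= mulf_eq0 orbb.
Qed.

Lemma dot_gt0 u : u != 0 -> 0 < dot u u.
Proof.
by move=> u0; rewrite lt_def dot_ge0 andbT; apply: contra u0 => /eqP/dot_eq0->.
Qed.

Lemma cdotC k u v : cdot k u v = cdot k v u.
Proof. by apply: eq_bigr => i _; rewrite mulrC. Qed.
Lemma cdotDr k u v w : cdot k u (v + w) = cdot k u v + cdot k u w.
Proof. by rewrite -big_split; apply: eq_bigr => i _ /=; rewrite coD mulrDr. Qed.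
Lemma cdotDl k u v w : cdot k (v + w) u = cdot k v u + cdot k w u.
Proof. by rewrite cdotC cdotDr !(cdotC k u). Qed.
Lemma cdotNr k u v : cdot k u (- v) = - cdot k u v.
Proof. by rewrite -sumrN; apply: eq_bigr => i _ /=; rewrite coN mulrN. Qed.
Lemma cdotNl k u v : cdot k (- v) u = - cdot k v u.
Proof. by rewrite cdotC cdotNr cdotC. Qed.
Lemma cdotZr k c u v : cdot k u (c *: v) = c * cdot k u v.
Proof. by rewrite mulr_sumr; apply: eq_bigr => i _ /=; rewrite coZ mulrCA. Qed.
Lemma cdotZl k c u v : cdot k (c *: v) u = c * cdot k v u.
Proof. by rewrite cdotC cdotZr cdotC. Qed.
Lemma cdot0r k u : cdot k u 0 = 0.
Proof. by apply: big1 => i _; rewrite co0 mulr0. Qed.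
Lemma cdot0l k u : cdot k 0 u = 0.
Proof. by rewrite cdotC cdot0r. Qed.

Definition cdotE := (cdotDr, cdotDl, cdotNr, cdotNl, cdotZr, cdotZl, cdot0r, cdot0l).

Lemma cdot_ge0 k u : 0 <= cdot k u u.
Proof. by apply: sumr_ge0 => i _; rewrite -expr2 sqr_ge0. Qed.

Lemma cdot_eq0 k u i : cdot k u u = 0 -> (2 <= i <= k)%N -> co u i = 0.
Proof.
move=> /eqP; rewrite psumr_eq0; last by move=> j _; rewrite -expr2 sqr_ge0.
move=> /allP u0 ik; apply/eqP; have := u0 i; rewrite mem_index_iota ltnS ik.
by move=> /(_ isT); rewrite /= mulf_eq0 orbb.
Qed.

Definition evec (i : nat) : V := vec (fun j => (j == i)%:R).

Lemma co_evec i j : (0 < j <= n.+1)%N -> co (evec i) j = (j == i)%:R.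
Proof. exact: co_vec. Qed.

Lemma cdot_evec k u i : (2 <= i <= n.+1)%N -> (k <= n.+1)%N ->
  cdot k u (evec i) = if (i <= k)%N then co u i else 0.
Proof.
move=> /andP[i2 iN] kN.
have E j : (2 <= j < k.+1)%N ->
    co u j * co (evec i) j = if j == i then co u j else 0.
  move=> /andP[j2 jk]; rewrite co_evec.
    by case: eqP => _; rewrite ?mulr1 ?mulr0.
  by rewrite (ltnW j2)/= (leq_trans _ kN).
rewrite /cdot (eq_big_nat _ _ E); case: leqP => ik.
  rewrite (bigD1_seq i) ?mem_index_iota ?iota_uniq ?i2//= eqxx big1 ?addr0//.
  by move=> j /negPf->.
rewrite big_nat_cond big1// => j /andP[/andP[_ jk] _]; case: eqP => // ji.
by move: jk; rewrite ji ltnS leqNgt ik.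
Qed.

Lemma cdot_evec1 k u : (k <= n.+1)%N -> cdot k u (evec 1) = 0.
Proof.
move=> kN; rewrite /cdot big_nat_cond big1// => j /andP[/andP[j2 jk] _].
rewrite co_evec; last by rewrite (ltnW j2)/= (leq_trans _ kN).
by case: j j2 {jk} => [|[|j]]//= _; rewrite mulr0.
Qed.

Lemma dot_evec u i : (0 < i <= n.+1)%N -> dot u (evec i) = co u i.
Proof.
case: i => // i /andP[_ iN]; rewrite /dot (bigD1 (Ordinal iN))//= big1.
  rewrite addr0 mxE eqxx mulr1 /co; congr (u _ _).
  by apply/val_inj; rewrite /= inordK.
move=> j ji; rewrite mxE eqSS.
by rewrite -[_ == i :> nat]/(j == Ordinal iN) (negPf ji) mulr0.
Qed.

Lemma is_diff_co (x : V) i : is_diff x (fun q => co q i) (fun w => co w i).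
Proof.
have lin : linear (fun q : V => co q i) by move=> c u v; rewrite coD coZ.
pose f : {linear V -> R} := HB.pack (fun q : V => co q i)
  (GRing.isLinear.Build _ _ _ _ _ lin).
have fc : continuous f by exact: coord_continuous.
by split; [exact: (@linear_differentiable _ _ _ f)|exact: (diff_lin x fc)].
Qed.

End Coordinates.

(** * Conjugate potentials *)

Section Potentials.
Context {R : realType} {n : nat}.
Notation V := 'rV[R]_n.+1.
Implicit Types (a m : R) (q v w : V).

Lemma onea2_gt0 a : 0 < 1 + a ^+ 2.
Proof. by rewrite ltr_pwDl// sqr_ge0. Qed.

Lemma onea2_neq0 a : 1 + a ^+ 2 != 0.
Proof. by rewrite gt_eqF// onea2_gt0. Qed.

Lemma sqrt_onea2_neq0 a : Num.sqrt (1 + a ^+ 2) != 0.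
Proof. by rewrite gt_eqF// sqrtr_gt0 onea2_gt0. Qed.

(* On the sphere this is sin^2 theta_Z for the Kepler center Z = Z1 a. *)
Definition kden a q : R :=
  (co q 1 + a * co q n.+1) ^+ 2 / (1 + a ^+ 2) + cdot n q q.

Definition dkden a q w : R :=
  2 * (co q 1 + a * co q n.+1) * (co w 1 + a * co w n.+1) / (1 + a ^+ 2)
  + 2 * cdot n q w.

(* kforce a is cot theta_Z for Z = Z1 a; in E_sp, kconj a takes its place. *)
Definition kforce a q : R :=
  (a * co q 1 - co q n.+1) / (Num.sqrt (1 + a ^+ 2) * Num.sqrt (kden a q)).

Definition dkforce a q w : R :=
  ((a * co w 1 - co w n.+1) / Num.sqrt (kden a q)
   - (a * co q 1 - co q n.+1) * dkden a q w / (2 * Num.sqrt (kden a q) ^+ 3))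
  / Num.sqrt (1 + a ^+ 2).

Definition kconj a q : R :=
  co q n.+1 / (Num.sqrt (1 + a ^+ 2) * Num.sqrt (kden a q)).

Definition dkconj a q w : R :=
  (co w n.+1 / Num.sqrt (kden a q)
   - co q n.+1 * dkden a q w / (2 * Num.sqrt (kden a q) ^+ 3))
  / Num.sqrt (1 + a ^+ 2).

Definition hforce q : R := (co q 1 ^+ 2 + cdot n q q) / co q n.+1 ^+ 2.

Definition dhforce q w : R :=
  (2 * co q 1 * co w 1 + 2 * cdot n q w) / co q n.+1 ^+ 2
  - 2 * (co q 1 ^+ 2 + cdot n q q) * co w n.+1 / co q n.+1 ^+ 3.

Definition hconj a q : R :=
  (co q 1 ^+ 2 / (1 + a ^+ 2) + cdot n q q) / co q n.+1 ^+ 2.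

Definition dhconj a q w : R :=
  (2 * co q 1 * co w 1 / (1 + a ^+ 2) + 2 * cdot n q w) / co q n.+1 ^+ 2
  - 2 * (co q 1 ^+ 2 / (1 + a ^+ 2) + cdot n q q) * co w n.+1 / co q n.+1 ^+ 3.

Lemma is_diff_cdot k q :
  is_diff q (fun y => cdot k y y) (fun w => 2 * cdot k q w).
Proof.
apply: (@is_diff_ext _ _ _ (fun w => \sum_(2 <= i < k.+1) 2 * (co q i * co w i))).
  apply: is_diff_bigsum => i.
  apply: is_diff_ext (is_diff_mul (is_diff_co q i) (is_diff_co q i)) _ => w.
  by rewrite mulr_natl mulr2n.
by move=> w; rewrite -mulr_sumr.
Qed.

Lemma is_diff_lin1 a q :
  is_diff q (fun y => co y 1 + a * co y n.+1)
            (fun w => co w 1 + a * co w n.+1).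
Proof. exact: is_diff_add (is_diff_co _ _) (is_diff_scale _ (is_diff_co _ _)). Qed.

Lemma is_diff_kden a q : is_diff q (kden a) (dkden a q).
Proof.
apply: is_diff_ext (is_diff_add (is_diff_mul (is_diff_sqr (is_diff_lin1 a q))
  (is_diff_const (1 + a ^+ 2)^-1 q)) (is_diff_cdot n q)) _ => w.
by rewrite /dkden mulr0 add0r [_^-1 * _]mulrC.
Qed.

Lemma is_diff_ratio (N D : V -> R) dN dD q c : is_diff q N dN -> is_diff q D dD ->
  0 < D q ->
  is_diff q (fun y => N y / (c * Num.sqrt (D y)))
    (fun w => (dN w / Num.sqrt (D q)
               - N q * dD w / (2 * Num.sqrt (D q) ^+ 3)) / c).
Proof.
move=> Nd Dd D0; have r0 : Num.sqrt (D q) != 0 by rewrite gt_eqF ?sqrtr_gt0.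
have -> : (fun y => N y / (c * Num.sqrt (D y))) =
    (fun y => c^-1 * (N y * (Num.sqrt (D y))^-1)).
  by apply/funext => y; rewrite invfM mulrCA.
apply: is_diff_ext (is_diff_scale _ (is_diff_mul Nd
  (is_diff_inv (is_diff_sqrt Dd D0) r0))) _ => w.
rewrite [RHS]mulrC; congr (_ * _); field.
by rewrite r0.
Qed.

Lemma is_diff_kforce a q : 0 < kden a q -> is_diff q (kforce a) (dkforce a q).
Proof.
move=> D0; apply: is_diff_ratio D0; last exact: is_diff_kden.
exact: is_diff_sub (is_diff_scale _ (is_diff_co _ _)) (is_diff_co _ _).
Qed.

Lemma is_diff_kconj a q : 0 < kden a q -> is_diff q (kconj a) (dkconj a q).
Proof.
move=> D0; apply: is_diff_ratio D0; last exact: is_diff_kden.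
exact: is_diff_co.
Qed.

Lemma is_diff_hratio (N : V -> R) dN q : is_diff q N dN -> co q n.+1 != 0 ->
  is_diff q (fun y => N y / co y n.+1 ^+ 2)
   (fun w => dN w / co q n.+1 ^+ 2 - 2 * N q * co w n.+1 / co q n.+1 ^+ 3).
Proof.
move=> Nd z0; have z20 : co q n.+1 ^+ 2 != 0 by rewrite expf_neq0.
apply: is_diff_ext (is_diff_mul Nd (is_diff_inv
  (is_diff_sqr (is_diff_co q n.+1)) z20)) _ => w.
field.
by rewrite z0.
Qed.

Lemma is_diff_hforce q : co q n.+1 != 0 -> is_diff q hforce (dhforce q).
Proof.
apply: is_diff_hratio.
exact: is_diff_add (is_diff_sqr (is_diff_co _ _)) (is_diff_cdot _ _).
Qed.

Lemma is_diff_hconj a q : co q n.+1 != 0 -> is_diff q (hconj a) (dhconj a q).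
Proof.
apply: is_diff_hratio; apply: is_diff_add (is_diff_cdot _ _).
apply: is_diff_ext (is_diff_mul (is_diff_sqr (is_diff_co q 1))
  (is_diff_const (1 + a ^+ 2)^-1 q)) _ => w.
by rewrite mulr0 add0r mulrC.
Qed.

(* The velocity at q of the rotation in the (q_i, q_(n+1)) plane. *)
Definition polar i q : V := co q n.+1 *: evec i - co q i *: evec n.+1.

(** The scalar product of v and [polar i q], that is, the angular momentum of the rotation in the
    (q_i, q_(n+1)) plane. *)
Definition angmom i q v : R := co q n.+1 * co v i - co q i * co v n.+1.

Section Duality.
Context (hn : (2 <= n)%N) (q : V) (q1 : dot q q = 1).

Let n0 : (0 < n)%N. Proof. exact: leq_trans hn. Qed.

Lemma sphere_cdot : cdot n q q = 1 - co q 1 ^+ 2 - co q n.+1 ^+ 2.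
Proof. by rewrite -q1 dot_cdot//; ring. Qed.

Lemma polar1E :
  [/\ co (polar 1 q) 1 = co q n.+1, co (polar 1 q) n.+1 = - co q 1
    & cdot n q (polar 1 q) = 0].
Proof.
rewrite /polar !coE !cdotE !co_evec ?leqnn// cdot_evec1// cdot_evec ?ltnS ?n0 ?leqnn//.
by rewrite ltnn !eqxx (gtn_eqF (_ : 1 < n.+1)%N)// (ltn_eqF (_ : 1 < n.+1)%N)//=;
  split; ring.
Qed.

Lemma polarE i : (2 <= i <= n)%N ->
  [/\ co (polar i q) 1 = 0, co (polar i q) n.+1 = - co q i
    & cdot n q (polar i q) = co q n.+1 * co q i].
Proof.
move=> /andP[i2 iN]; have iN' : (2 <= i <= n.+1)%N by rewrite i2 leqW.
rewrite /polar !coE !cdotE !co_evec ?leqnn// !cdot_evec ?iN ?ltnn ?ltnS ?n0 ?leqnn//.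
rewrite (gtn_eqF (_ : i < n.+1)%N)// eqxx (ltn_eqF i2) (ltn_eqF (_ : 1 < n.+1)%N)//.
by rewrite /=; split; ring.
Qed.

(** In both dualities the force along [polar i q] is q_i times a factor independent of i; this
    closes the resulting sum. *)
Lemma sum_angmom v :
  \sum_(2 <= i < n.+1) angmom i q v * co q i
  = co q n.+1 * cdot n q v - cdot n q q * co v n.+1.
Proof.
rewrite /cdot mulr_sumr mulr_suml -sumrB; apply: eq_bigr => i _.
by rewrite /angmom; ring.
Qed.

(** Solved for [cdot n q q], so that the root can be generalised to a variable and [field] never
    meets a square root. *)
Lemma sqrt_kden3 a : 0 < kden a q ->
  cdot n q q = Num.sqrt (kden a q) ^+ 2 - (co q 1 + a * co q n.+1) ^+ 2 / (1 + a ^+ 2).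
Proof. by move=> D0; rewrite sqr_sqrtr ?(ltW D0)// /kden addrC addKr. Qed.

(** On the sphere the force is c / sqrt (1 - c^2) with c = cos theta, and its derivative in c is 1 /
    sin^3 theta. Along [polar 1 q], c changes at the rate (q_1 + a q_(n+1)) / sqrt (1 + a^2), along
    the other [polar i q] at the rate q_i / sqrt (1 + a^2). *)
Lemma dkforce_polar1 a : 0 < kden a q ->
  dkforce a q (polar 1 q) = (co q 1 + a * co q n.+1)
    / (Num.sqrt (1 + a ^+ 2) * Num.sqrt (kden a q) ^+ 3).
Proof.
move=> D0; have r0 : Num.sqrt (kden a q) != 0 by rewrite gt_eqF ?sqrtr_gt0.
have s0 := sqrt_onea2_neq0 a; have a0 := onea2_neq0 a.
have := sqrt_kden3 D0; rewrite sphere_cdot => E.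
rewrite /dkforce /dkden; have [-> -> ->] := polar1E.
move: r0 s0 E; move: (Num.sqrt (kden a q)) (Num.sqrt (1 + _)) => r s r0 s0 E.
have r2 : r ^+ 2 = 1 - (a * co q 1 - co q n.+1) ^+ 2 / (1 + a ^+ 2).
  by move/eqP: E; rewrite eq_sym subr_eq => /eqP->; field.
(* The inserted factor is sin^2 theta + cos^2 theta, which [r2] turns into 1. *)
transitivity ((co q 1 + a * co q n.+1) *
  (r ^+ 2 + (a * co q 1 - co q n.+1) ^+ 2 / (1 + a ^+ 2)) / (s * r ^+ 3)).
  by field; rewrite r0 s0 a0.
by rewrite r2 subrK mulr1.
Qed.

Lemma dkforce_polar a i : 0 < kden a q -> (2 <= i <= n)%N ->
  dkforce a q (polar i q) = co q i
    / (Num.sqrt (1 + a ^+ 2) * Num.sqrt (kden a q) ^+ 3).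
Proof.
move=> D0 iN; have r0 : Num.sqrt (kden a q) != 0 by rewrite gt_eqF ?sqrtr_gt0.
have s0 := sqrt_onea2_neq0 a; have a0 := onea2_neq0 a.
have := sqrt_kden3 D0; rewrite sphere_cdot => E.
rewrite /dkforce /dkden; have [-> -> ->] := polarE iN.
move: r0 s0 E; move: (Num.sqrt (kden a q)) (Num.sqrt (1 + _)) => r s r0 s0 E.
have r2 : r ^+ 2 = 1 - (a * co q 1 - co q n.+1) ^+ 2 / (1 + a ^+ 2).
  by move/eqP: E; rewrite eq_sym subr_eq => /eqP->; field.
transitivity (co q i *
  (r ^+ 2 + (a * co q 1 - co q n.+1) ^+ 2 / (1 + a ^+ 2)) / (s * r ^+ 3)).
  by field; rewrite r0 s0 a0.
by rewrite r2 subrK mulr1.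
Qed.

(* Along the motion angmom i q v changes at the rate dU (polar i q), so that this
   is the conservation of E_sp by the force kforce a. *)
Lemma kepler_duality a v : 0 < kden a q ->
  angmom 1 q v * dkforce a q (polar 1 q) / (1 + a ^+ 2)
  + \sum_(2 <= i < n.+1) angmom i q v * dkforce a q (polar i q)
  + dkconj a q v = 0.
Proof.
move=> D0; have r0 : Num.sqrt (kden a q) != 0 by rewrite gt_eqF ?sqrtr_gt0.
have s0 := sqrt_onea2_neq0 a; have a0 := onea2_neq0 a.
rewrite dkforce_polar1//.
rewrite (eq_big_nat _ _ (F2 := fun i => angmom i q v * co q i *
   (Num.sqrt (1 + a ^+ 2) * Num.sqrt (kden a q) ^+ 3)^-1)); last first.
  by move=> i iN; rewrite dkforce_polar// mulrA.
rewrite -mulr_suml sum_angmom /dkconj /dkden /angmom (sqrt_kden3 D0).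
move: r0 s0; move: (Num.sqrt (kden a q)) (Num.sqrt (1 + _)) => r s r0 s0.
by field; rewrite r0 s0 a0.
Qed.

(** On the sphere tan^2 theta = q_(n+1)^-2 - 1, which changes along [polar i q] at the rate 2 q_i /
    q_(n+1)^3. *)
Lemma hooke_duality a v : co q n.+1 != 0 ->
  angmom 1 q v * dhforce q (polar 1 q) / (1 + a ^+ 2)
  + \sum_(2 <= i < n.+1) angmom i q v * dhforce q (polar i q)
  = dhconj a q v.
Proof.
move=> z0; have a0 := onea2_neq0 a.
rewrite (eq_big_nat _ _ (F2 := fun i => angmom i q v * co q i *
   (2 / co q n.+1 ^+ 3))); last first.
  move=> i iN; rewrite /dhforce; have [-> -> ->] := polarE iN.
  by rewrite sphere_cdot; field.
rewrite -mulr_suml sum_angmom /dhconj /dhforce /angmom.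
have [-> -> ->] := polar1E; rewrite sphere_cdot.
by field; rewrite z0 a0.
Qed.

End Duality.
End Potentials.

(** * Functions of position or velocity alone, and functions along curves *)

Section ProductDifferentials.
Context {R : realType} {U1 U2 : normedModType R}.

Lemma is_diff_fst (g : U1 -> R) dg (x : U1 * U2) : is_diff (x.1) g dg ->
  is_diff x (fun y : U1 * U2 => g y.1) (fun w => dg w.1).
Proof.
move=> gd; have fd : is_diff x (fst : U1 * U2 -> U1) fst.
  have c : continuous (fst : U1 * U2 -> U1) by move=> y; exact: cvg_fst.
  by split; [exact: linear_differentiable|exact: diff_lin].
exact: is_diff_comp fd gd.
Qed.

Lemma is_diff_snd (g : U2 -> R) dg (x : U1 * U2) : is_diff (x.2) g dg ->
  is_diff x (fun y : U1 * U2 => g y.2) (fun w => dg w.2).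
Proof.
move=> gd; have fd : is_diff x (snd : U1 * U2 -> U2) snd.
  have c : continuous (snd : U1 * U2 -> U2) by move=> y; exact: cvg_snd.
  by split; [exact: linear_differentiable|exact: diff_lin].
exact: is_diff_comp fd gd.
Qed.

End ProductDifferentials.

Lemma is_diff_curve (R : realType) (U : normedModType R) (q : R -> U) t :
  derivable q t 1 -> is_diff t q ( *:%R^~ (derive1 q t)).
Proof.
by move=> dq; apply: DiffDef; [exact/derivable1_diffP|exact: deriv1E].
Qed.

Lemma cst_derive0 (R : realType) (g : R -> R) (t0 t1 : R) :
  (forall t, t0 < t < t1 -> is_derive t 1 g 0) ->
  forall s t, t0 < s < t1 -> t0 < t < t1 -> g s = g t.
Proof.
move=> g0; suff H s t : s <= t -> t0 < s -> t < t1 -> g s = g t.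
  move=> s t /andP[? ?] /andP[? ?]; case: (leP s t) => st; first exact: H.
  by apply/esym/H => //; exact: ltW.
move=> st t0s tt1.
have I x : s <= x <= t -> t0 < x < t1.
  by move=> /andP[sx xt]; rewrite (lt_le_trans t0s)//= (le_lt_trans _ tt1).
have [||c _] := @MVT_segment _ g (fun=> 0) s t st.
- by move=> x; rewrite in_itv/= => /andP[sx xt]; apply/g0/I; rewrite !ltW.
- apply: derivable_within_continuous => x; rewrite in_itv/= => /I/g0[].
  by [].
- by rewrite mul0r => /subr0_eq ->.
Qed.

(** * Hamiltonian vectors on the tangent bundle of the sphere *)

Section Hamiltonian.
Context {R : realType} {n : nat}.
Notation V := 'rV[R]_n.+1.
Implicit Types (F G : V * V -> R) (x w X : V * V).

Lemma omegaC X w : omega X w = - omega w X.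
Proof. by rewrite /omega opprB ![dot w.1 _]dotC ![dot w.2 _]dotC. Qed.

(** With A and B the gradients of F in q and v, the ambient Hamiltonian vector (B, - A) is corrected
    by multiples of (q, - v) and (0, - q), the Hamiltonian vectors of the constraints q.v and |q|^2
    / 2. These pair to 0 with tangent vectors, and tangency dictates the multiples. *)
Lemma hamiltonian_vector_exists F x : dot x.1 x.1 = 1 -> dot x.1 x.2 = 0 ->
  exists X, is_hamiltonian_vector F x X.
Proof.
case: x => q v /= q1 qv.
pose A : V := \row_j 'd F (q, v) (delta_mx 0 j, 0).
pose B : V := \row_j 'd F (q, v) (0, delta_mx 0 j).
have dA (u : V) : 'd F (q, v) (u, 0) = dot A u.
  have -> : (u, 0) = \sum_j u ord0 j *: (delta_mx 0 j, 0) :> V * V.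
    apply: injective_projections => /=.
      rewrite (big_morph fst (id1 := 0) (op1 := +%R))//.
      by rewrite {1}(row_sum_delta u); apply: eq_bigr.
    rewrite (big_morph snd (id1 := 0) (op1 := +%R))//=.
    by rewrite big1// => j _; rewrite scaler0.
  by rewrite linear_sum; apply: eq_bigr => j _; rewrite linearZ mxE mulrC.
have dB (u : V) : 'd F (q, v) (0, u) = dot B u.
  have -> : (0, u) = \sum_j u ord0 j *: (0, delta_mx 0 j) :> V * V.
    apply: injective_projections => /=.
      rewrite (big_morph fst (id1 := 0) (op1 := +%R))//=.
      by rewrite big1// => j _; rewrite scaler0.
    rewrite (big_morph snd (id1 := 0) (op1 := +%R))//.
    by rewrite {1}(row_sum_delta u); apply: eq_bigr.
  by rewrite linear_sum; apply: eq_bigr => j _; rewrite linearZ mxE mulrC.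
have dF (w : V * V) : 'd F (q, v) w = dot A w.1 + dot B w.2.
  rewrite -dA -dB -linearD; congr ('d F _ _).
  by apply: injective_projections; rewrite /= ?addr0 ?add0r.
exists (B - dot q B *: q, - A + dot q B *: v - (dot v B - dot q A) *: q).
split; rewrite /tangent2/=.
  rewrite !dotE q1 qv [dot v q]dotC qv.
  by split; ring.
move=> [w1 w2] [/= qw1 vw1]; rewrite dF /omega/= !dotE qw1.
rewrite (_ : dot v w1 = - dot q w2); first by ring.
by move: vw1 => /eqP; rewrite addr_eq0 => /eqP.
Qed.

(** [X] and the vector that [xget] chooses for F both represent the differential of F, so they pair
    alike with the vector chosen for G. Any explicit Hamiltonian vector can thus stand in for the
    chosen one. *)
Lemma bracket_hamiltonian F G x X : dot x.1 x.1 = 1 -> dot x.1 x.2 = 0 ->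
  is_hamiltonian_vector F x X -> poisson_bracket F G x = - 'd G x X.
Proof.
move=> q1 qv hX; have [tX eX] := hX.
have [_ eF] : is_hamiltonian_vector F x (hamiltonian_vector F x).
  exact: (xgetPex 0 (hamiltonian_vector_exists F q1 qv)).
have [tG eG] : is_hamiltonian_vector G x (hamiltonian_vector G x).
  exact: (xgetPex 0 (hamiltonian_vector_exists G q1 qv)).
by rewrite /poisson_bracket eF// -eX// omegaC eG.
Qed.

Lemma bracketC F G x : poisson_bracket F G x = - poisson_bracket G F x.
Proof. exact: omegaC. Qed.

Lemma bracket_self F x : poisson_bracket F F x = 0.
Proof. by rewrite /poisson_bracket /omega [dot _ (_ F x).1]dotC subrr. Qed.

Lemma is_diff_dot12 x : is_diff x (fun y : V * V => dot y.1 y.2)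
  (fun w => dot x.1 w.2 + dot x.2 w.1).
Proof.
have H i : is_diff x (fun y : V * V => co y.1 i * co y.2 i)
    (fun w => co x.1 i * co w.2 i + co x.2 i * co w.1 i).
  apply: is_diff_mul; first exact: (is_diff_fst (is_diff_co x.1 i)).
  exact: (is_diff_snd (is_diff_co x.2 i)).
have -> : (fun y : V * V => dot y.1 y.2) =
    (fun y => \sum_(1 <= i < n.+2) co y.1 i * co y.2 i).
  by apply/funext => y; rewrite dot_sum.
apply: is_diff_ext (is_diff_bigsum _ H) _ => w.
by rewrite big_split -!dot_sum.
Qed.

Lemma is_diff_dot1 (q : V) :
  is_diff q (fun y : V => dot y y) (fun w : V => 2 * dot q w).
Proof.
have H i : is_diff q (fun y : V => co y i * co y i)
    (fun w : V => co q i * co w i + co q i * co w i).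
  exact: is_diff_mul (is_diff_co q i) (is_diff_co q i).
have -> : (fun y : V => dot y y) =
    (fun y => \sum_(1 <= i < n.+2) co y i * co y i).
  by apply/funext => y; rewrite dot_sum.
apply: is_diff_ext (is_diff_bigsum _ H) _ => w.
by rewrite big_split -!dot_sum mulr_natl mulr2n.
Qed.

(* A motion is an integral curve of the Hamiltonian vector field of the energy,
   so that its velocity in the phase space pairs with 'd F into the bracket. *)
Lemma first_integral_bracket (S : mech_system) E F :
  (forall x, phase_space S x -> forall w,
     'd E x w = dot x.2 w.2 - 'd (force S) (x.1) w.1) ->
  (forall x, phase_space S x -> differentiable F x) ->
  (forall x, phase_space S x -> poisson_bracket E F x = 0) ->
  first_integral S F.
Proof.
move=> dE dF EF0 t0 t1 q qm.
pose c t : V * V := (q t, derive1 q t).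
pose c' t : V * V := (derive1 q t, derive1 (derive1 q) t).
have dc t : t0 < t < t1 -> is_diff t c (fun h => h *: c' t).
  move=> /qm[_ q1 q2 _].
  exact: is_diff_pair (is_diff_curve q1) (is_diff_curve q2).
have der (G : V * V -> R) dG t : t0 < t < t1 -> is_diff (c t) G dG ->
    is_derive t 1 (G \o c) (dG (c' t)).
  move=> tt Gd; have [d e] := is_diff_comp (dc t tt) Gd.
  apply: DeriveDef; first exact/derivable1_diffP.
  by rewrite deriveE// e/= scale1r.
have near_itv t : t0 < t < t1 -> \forall s \near t, t0 < s < t1.
  move=> tt; have : t \in `]t0, t1[ by rewrite in_itv.
  by move=> /near_in_itvoo; apply: filterS => s; rewrite in_itv.
have der0 (G : V * V -> R) dG k t : t0 < t < t1 -> is_diff (c t) G dG ->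
    (forall s, t0 < s < t1 -> G (c s) = k) -> dG (c' t) = 0.
  move=> tt Gd Gk; have [_ <-] := der G dG t tt Gd.
  rewrite -(derive_cst k t 1); apply: near_eq_derive.
  by apply: filterS (near_itv t tt) => s; exact: Gk.
have sph t : t0 < t < t1 -> dot (q t) (q t) = 1 by move=> /qm[[]].
(* Differentiating |q|^2 = 1, and then q.q' = 0, puts the motion in [phase_space] and its velocity
   in [tangent2]. *)
have tan1 t : t0 < t < t1 -> dot (q t) (derive1 q t) = 0.
  move=> tt; have := der0 _ _ 1 t tt (is_diff_fst (is_diff_dot1 (c t).1)) sph.
  by move/eqP; rewrite mulf_eq0 pnatr_eq0/= => /eqP.
have tan2 t : t0 < t < t1 -> tangent2 (c t) (c' t).
  move=> tt; split; first exact: tan1.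
  by rewrite addrC; exact: (der0 _ _ 0 t tt (is_diff_dot12 (c t)) tan1).
have ph t : t0 < t < t1 -> phase_space S (c t).
  by move=> tt; split; [have [] := qm t tt|exact: tan1].
have ham t : t0 < t < t1 -> is_hamiltonian_vector E (c t) (c' t).
  move=> tt; split; first exact: tan2.
  move=> w [/= qw _]; rewrite (dE _ (ph _ tt)) /omega/=; congr (_ - _).
  have [_ _ _ [_ gradq]] := qm t tt.
  (* The acceleration and its tangential part differ by a multiple of q, which is orthogonal to
     [w.1]. *)
  by rewrite -(gradq _ qw) /tproj dotDl dotNl dotZl qw mulr0 subr0.
apply: (cst_derive0 (g := F \o c)) => t tt.
have Fd : is_diff (c t) F ('d F (c t)) by exact/differentiableP/dF/ph.
have := der F _ t tt Fd.
suff -> : 'd F (c t) (c' t) = 0 by [].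
apply: oppr_inj; rewrite oppr0.
rewrite -(@bracket_hamiltonian E F (c t) _ (sph t tt) (tan1 t tt) (ham t tt)).
exact: EF0 (ph t tt).
Qed.

End Hamiltonian.

(** * Angles to the centers *)

Section Angles.
Context {R : realType} {n : nat}.
Notation V := 'rV[R]_n.+1.
Implicit Types (a : R) (q : V).
Context (hn : (2 <= n)%N).

Let n0 : (0 < n)%N. Proof. exact: leq_trans hn. Qed.

Lemma co_Z1 a : [/\ co (Z1 n a) 1 = a / Num.sqrt (1 + a ^+ 2),
   co (Z1 n a) n.+1 = - (Num.sqrt (1 + a ^+ 2))^-1
   & forall i, (2 <= i <= n)%N -> co (Z1 n a) i = 0].
Proof.
rewrite /co /Z1 /kepler_center; split=> [||i /andP[i2 iN]]; rewrite mxE inordK//=.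
- by rewrite eqn0Ngt n0 eqxx.
- by case: i i2 iN => [|[|i]]//= _ iN; rewrite (ltn_eqF (_ : i.+1 < n)%N).
- by case: i i2 iN => //= i _; exact: ltnW.
Qed.

(** Reduces the second center to the first one with parameter - a. *)
Lemma Z2E a : Z2 n a = Z1 n (- a).
Proof. by []. Qed.

Lemma cdot_Z1 q a : cdot n q (Z1 n a) = 0.
Proof.
rewrite /cdot big_nat_cond big1// => i /andP[iN _].
by have [_ _ ->//] := co_Z1 a; rewrite mulr0.
Qed.

Lemma dot_Z1 q a :
  dot q (Z1 n a) = (a * co q 1 - co q n.+1) / Num.sqrt (1 + a ^+ 2).
Proof.
rewrite dot_cdot// cdot_Z1; have [-> -> _] := co_Z1 a.
by rewrite addr0; ring.
Qed.

Lemma sqr_sqrt_onea2 a : Num.sqrt (1 + a ^+ 2) ^+ 2 = 1 + a ^+ 2.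
Proof. by rewrite sqr_sqrtr// ltW// onea2_gt0. Qed.

Lemma dot_Z1_Z1 a : dot (Z1 n a) (Z1 n a) = 1.
Proof.
rewrite dot_Z1; have [-> -> _] := co_Z1 a; have := sqrt_onea2_neq0 a.
have := sqr_sqrt_onea2 a; move: (Num.sqrt _) => s s2 s0.
rewrite (_ : _ / s = (1 + a ^+ 2) / s ^+ 2); first by rewrite s2 divff ?onea2_neq0.
by field.
Qed.

(** As the center is a unit vector, the right-hand side is a Gram determinant, |q|^2 sin^2 theta;
    Cauchy-Schwarz then amounts to [kden_ge0]. *)
Lemma kden_dot a q : kden a q = dot q q - dot q (Z1 n a) ^+ 2.
Proof.
rewrite /kden dot_Z1 dot_cdot// expr_div_n sqr_sqrt_onea2.
by field; rewrite onea2_neq0.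
Qed.

Lemma kden_ge0 a q : 0 <= kden a q.
Proof.
by rewrite addr_ge0 ?cdot_ge0// mulr_ge0 ?sqr_ge0// invr_ge0 ltW// onea2_gt0.
Qed.

Lemma enorm_Z1 a : enorm (Z1 n a) = 1.
Proof. by rewrite /enorm dot_Z1_Z1 sqrtr1. Qed.

Lemma enorm_gt0 q : q != 0 -> 0 < enorm q.
Proof. by move=> q0; rewrite sqrtr_gt0 dot_gt0. Qed.

Lemma sqr_enorm q : enorm q ^+ 2 = dot q q.
Proof. by rewrite sqr_sqrtr// dot_ge0. Qed.

Lemma cos_itv (x : R) : x ^+ 2 <= 1 -> -1 <= x <= 1.
Proof. by move=> x1; apply/andP; split; nra. Qed.

Lemma sqr_cos_Z1 a q : q != 0 -> (dot q (Z1 n a) / enorm q) ^+ 2 <= 1.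
Proof.
move=> q0; rewrite expr_div_n ler_pdivrMr ?exprn_gt0 ?enorm_gt0// mul1r sqr_enorm.
by rewrite -subr_ge0 -kden_dot kden_ge0.
Qed.

Lemma angle_Z1 a q : angle q (Z1 n a) = acos (dot q (Z1 n a) / enorm q).
Proof. by rewrite /angle enorm_Z1 mulr1. Qed.

Lemma cot_angle_Z1 a q : q != 0 -> cot (angle q (Z1 n a)) = kforce a q.
Proof.
move=> q0; have e0 := enorm_gt0 q0; have c1 := sqr_cos_Z1 a q0.
have cI := cos_itv c1.
rewrite /cot angle_Z1 sin_acos// acosK ?in_itv//.
have -> : 1 - (dot q (Z1 n a) / enorm q) ^+ 2 = kden a q / enorm q ^+ 2.
  by rewrite kden_dot -sqr_enorm; field; rewrite gt_eqF.
rewrite sqrtrM ?kden_ge0// sqrtrV ?sqr_ge0// sqrtr_sqr (gtr0_norm e0).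
rewrite /kforce dot_Z1.
(* On the line through the center both sides are 0, because the inverse of 0 is 0. [tan2_angle_Z0]
   treats the equator likewise. *)
have [->|d0] := eqVneq (Num.sqrt (kden a q)) 0; first by rewrite mul0r !mulr0 !invr0 !mulr0.
by field; rewrite d0 sqrt_onea2_neq0 gt_eqF.
Qed.

Lemma dot_Z0 q : dot q (Z0 n) = - co q n.+1.
Proof.
rewrite /dot big_ord_recr/= big1 ?add0r.
  rewrite mxE eqxx mulrN mulr1 /co; congr (- q _ _).
  by apply/val_inj; rewrite /= inordK.
by move=> i _; rewrite mxE/= ltn_eqF// mulr0.
Qed.

Lemma enorm_Z0 : enorm (Z0 n : V) = 1.
Proof. by rewrite /enorm dot_Z0 /co mxE inordK//= eqxx opprK sqrtr1. Qed.

Lemma tan2_angle_Z0 q : q != 0 -> tan (angle q (Z0 n)) ^+ 2 = hforce q.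
Proof.
move=> q0; have e0 := enorm_gt0 q0.
rewrite /angle enorm_Z0 mulr1 dot_Z0.
have z2 : co q n.+1 ^+ 2 = dot q q - (co q 1 ^+ 2 + cdot n q q).
  by rewrite dot_cdot//; ring.
have c1 : (- co q n.+1 / enorm q) ^+ 2 <= 1.
  rewrite expr_div_n sqrrN ler_pdivrMr ?exprn_gt0 ?enorm_gt0// mul1r sqr_enorm.
  by rewrite z2 gerBl addr_ge0 ?sqr_ge0 ?cdot_ge0.
have cI := cos_itv c1.
rewrite /tan sin_acos// acosK ?in_itv// expr_div_n sqr_sqrtr ?subr_ge0//.
rewrite /hforce expr_div_n sqrrN sqr_enorm.
have d0 : dot q q != 0 by rewrite gt_eqF ?dot_gt0.
have [->|z0] := eqVneq (co q n.+1) 0; first by rewrite expr0n/= mul0r !invr0 !mulr0.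
have -> : co q 1 ^+ 2 + cdot n q q = dot q q - co q n.+1 ^+ 2 by rewrite z2; ring.
by field; rewrite z0 d0.
Qed.

(** If [kden] vanishes, both its nonnegative summands do, which puts q on the line through the
    center; the unit norm leaves only the center and its antipode. *)
Lemma kden_gt0 a q : dot q q = 1 -> ~ (q = Z1 n a \/ q = - Z1 n a) -> 0 < kden a q.
Proof.
move=> q1 qZ; rewrite lt_def kden_ge0 andbT; apply/eqP => k0; apply: qZ.
have a0 := onea2_gt0 a; have s0 := sqrt_onea2_neq0 a.
have /andP[/eqP t0 /eqP r0] :
    ((co q 1 + a * co q n.+1) ^+ 2 / (1 + a ^+ 2) == 0) && (cdot n q q == 0).
  rewrite -paddr_eq0 ?cdot_ge0//; first exact/eqP.
  by rewrite mulr_ge0 ?sqr_ge0// invr_ge0 ltW.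
move/eqP: t0; rewrite mulf_eq0 invr_eq0 (gt_eqF a0) orbF sqrf_eq0 => /eqP t0.
have E1 : co q 1 = - a * co q n.+1 by rewrite mulNr; apply/eqP; rewrite -addr_eq0 t0.
have z2 : (co q n.+1 * Num.sqrt (1 + a ^+ 2)) ^+ 2 = 1.
  rewrite exprMn sqr_sqrt_onea2 -[RHS]q1 dot_cdot// r0 E1; ring.
have Ei i : (2 <= i <= n)%N -> co q i = 0 by exact: cdot_eq0.
have [Z1E ZNE ZiE] := co_Z1 a.
have key (e : R) : co q n.+1 * Num.sqrt (1 + a ^+ 2) = - e -> q = e *: Z1 n a.
  move=> ze; have zE : co q n.+1 = - e / Num.sqrt (1 + a ^+ 2) by rewrite -ze mulfK.
  apply: coP => i /andP[i0 iN]; rewrite coZ.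
  have [->|i1] := eqVneq i 1%N; first by rewrite Z1E E1 zE; field.
  have [->|iN1] := eqVneq i n.+1; first by rewrite ZNE zE mulNr mulrN.
  have i2 : (2 <= i <= n)%N.
    by rewrite ltn_neqAle eq_sym i1 i0 -ltnS ltn_neqAle iN1.
  by rewrite Ei// ZiE// mulr0.
move/eqP: z2; rewrite sqrf_eq1 => /orP[] /eqP z1.
- by right; rewrite -scaleN1r; apply: key; rewrite opprK.
- by left; rewrite -[RHS]scale1r; apply: key.
Qed.

End Angles.

(** A term of zero weight vanishes identically, hence is differentiable even where its formula is
    singular. *)
Lemma is_diff_weight (R : realType) (W : normedModType R) (c : R) (g dg : W -> R) x :
  (c <> 0 -> is_diff x g dg) ->
  is_diff x (fun y => c * g y) (fun w => c * dg w).
Proof.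
have [->|/eqP c0] := eqVneq c 0; last by move=> /(_ c0); exact: is_diff_scale.
move=> _; have -> : (fun y => 0 * g y) = (fun=> 0).
  by apply/funext => y; rewrite mul0r.
by apply: is_diff_ext (is_diff_const 0 x) _ => w; rewrite mul0r.
Qed.

Lemma Ck_weight (R : realType) (W : normedModType R) k (A : set W) (c : R) (g : W -> R) :
  open A -> (c <> 0 -> Ck k A g) -> Ck k A (fun y => c * g y).
Proof.
move=> oA; have [->|/eqP c0] := eqVneq c 0.
  by move=> _; apply: Ck_eq (Ck_cst k A 0) => // y _; rewrite mul0r.
by move=> /(_ c0); apply: Ck_mul => //; exact: Ck_cst.
Qed.

Lemma open_fst (U1 U2 : topologicalType) (A : set U1) : open A ->
  open [set x : U1 * U2 | A x.1].
Proof.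
by move=> oA; apply: (@open_comp _ _ fst A) => // x _; exact: cvg_fst.
Qed.

Lemma Ck_fst (R : realType) (U1 U2 : normedModType R) k (A : set U1) (g : U1 -> R) :
  open A -> Ck k A g -> Ck k [set x : U1 * U2 | A x.1] (fun x => g x.1).
Proof.
move=> oA; elim: k g => [|k IH] g /=.
  move=> cg x Ax; apply: (@continuous_comp _ _ _ fst g); first exact: cvg_fst.
  exact: cg.
move=> [dg Dg]; have d (x : U1 * U2) : A x.1 ->
    is_diff x (fun y : U1 * U2 => g y.1) (fun w => 'd g (x.1) w.1).
  by move=> Ax; exact/is_diff_fst/differentiableP/dg.
split=> [x Ax|v]; first by have [] := d x Ax.
apply: Ck_eq (IH _ (Dg v.1)); first exact: open_fst.
by move=> x Ax; have [d1 e] := d x Ax; rewrite [RHS]deriveE// e deriveE//; exact: dg.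
Qed.

Lemma open_pos (R : realType) (W : normedModType R) (P : Prop) (g : W -> R) :
  continuous g -> open [set x | P -> 0 < g x].
Proof.
move=> cg; have [p|np] := pselect P.
  rewrite (_ : [set x | _] = g @^-1` [set y | 0 < y]).
    by apply: open_comp => [x _|]; [exact: cg|exact: open_gt].
  by apply/seteqP; split=> x /=; [exact|move=> gx _].
rewrite (_ : [set x | _] = setT); first exact: openT.
by apply/seteqP; split=> // x _ /= /np.
Qed.

(** * Smoothness of the integrals *)

Section Lagrange.
Context {R : realType} {n : nat} (a hm1 hm2 f : R).
Notation V := 'rV[R]_n.+1.
Context (hn : (2 <= n)%N).
Implicit Types (q : V) (x w : V * V).
Notation S := (lagrange_problem n a hm1 hm2 f).

Let n0 : (0 < n)%N. Proof. exact: leq_trans hn. Qed.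

(** An open set of the ambient space containing the regular part of the sphere. The last condition
    is squared to be of the form treated by [open_pos]. *)
Definition force_domain : set V :=
  [set q | [/\ q != 0, hm1 <> 0 -> 0 < kden a q, hm2 <> 0 -> 0 < kden (- a) q
             & f <> 0 -> 0 < co q n.+1 ^+ 2]].

Definition lforce q := hm1 * kforce a q + hm2 * kforce (- a) q + f * hforce q.
Definition dlforce q (w : V) :=
  hm1 * dkforce a q w + hm2 * dkforce (- a) q w + f * dhforce q w.
Definition lconj q := hm1 * kconj a q + hm2 * kconj (- a) q - f * hconj a q.
Definition dlconj q (w : V) :=
  hm1 * dkconj a q w + hm2 * dkconj (- a) q w - f * dhconj a q w.

Lemma sqr_gt0 (z : R) : (0 < z ^+ 2) = (z != 0).
Proof. by rewrite lt_def sqr_ge0 andbT sqrf_eq0. Qed.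

Lemma open_domain : open force_domain.
Proof.
have -> : force_domain = [set q | True -> 0 < dot q q] `&` [set q | hm1 <> 0 -> 0 < kden a q]
   `&` ([set q | hm2 <> 0 -> 0 < kden (- a) q] `&` [set q | f <> 0 -> 0 < co q n.+1 ^+ 2]).
  apply/seteqP; split=> q /=.
    by case=> q0 h1 h2 h3; split; split=> // _; exact: dot_gt0.
  case=> -[/(_ I) q0 h1] [h2 h3]; split=> //.
  by apply: contraTneq q0 => ->; rewrite dot0r ltxx.
do ![apply: openI]; apply: open_pos => q; apply: differentiable_continuous.
- by have [] := is_diff_dot1 q.
- by have [] := is_diff_kden a q.
- by have [] := is_diff_kden (- a) q.
- by have [] := is_diff_sqr (is_diff_co q n.+1).
Qed.

Lemma regular_domain : regular S `<=` force_domain.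
Proof.
move=> q [qS]; rewrite /= !not_orP => -[[h1 h2] h3].
have q1 : dot q q = 1 by [].
split=> [|m1|m2|fn].
- by apply/eqP => q0; move/eqP: q1; rewrite q0 dot0r eq_sym oner_eq0.
- by apply: kden_gt0 => // qZ; apply: h1.
- by apply: kden_gt0 => // qZ; apply: h2.
- rewrite sqr_gt0; apply/eqP => z0; apply: h3; split=> //.
  by rewrite dot_Z0// z0 oppr0.
Qed.

Lemma force_lforce q : q != 0 -> force S q = lforce q.
Proof.
by move=> q0; rewrite /= Z2E !cot_angle_Z1// tan2_angle_Z0.
Qed.

Lemma is_diff_lforce q : force_domain q -> is_diff q lforce (dlforce q).
Proof.
case=> q0 h1 h2 h3; apply: is_diff_add; first apply: is_diff_add.
- by apply: is_diff_weight => /h1; exact: is_diff_kforce.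
- by apply: is_diff_weight => /h2; exact: is_diff_kforce.
- by apply: is_diff_weight => /h3; rewrite sqr_gt0; exact: is_diff_hforce.
Qed.

Lemma is_diff_lconj q : force_domain q -> is_diff q lconj (dlconj q).
Proof.
case=> q0 h1 h2 h3; apply: is_diff_sub; first apply: is_diff_add.
- by apply: is_diff_weight => /h1; exact: is_diff_kconj.
- by apply: is_diff_weight => /h2; exact: is_diff_kconj.
- by apply: is_diff_weight => /h3; rewrite sqr_gt0; exact: is_diff_hconj.
Qed.

Lemma near_domain q : force_domain q -> \forall y \near q, force_domain y.
Proof. by move=> ql; exact: open_nbhs_nbhs (conj open_domain ql). Qed.

Lemma is_diff_force q : force_domain q -> is_diff q (force S) (dlforce q).
Proof.
move=> ql; apply: near_is_diff (is_diff_lforce ql).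
by apply: filterS (near_domain ql) => y [y0 _ _ _]; rewrite force_lforce.
Qed.

Lemma Ck_co k A i : Ck k A (fun q : V => co q i).
Proof. by apply: Ck_lin => q; exact: is_diff_co. Qed.

Lemma Ck_cdot k A l : open A -> Ck k A (fun q : V => cdot l q q).
Proof.
by move=> oA; apply: Ck_sum => // i; apply: Ck_mul => //; exact: Ck_co.
Qed.

Lemma Ck_sqr k (W : normedModType R) (A : set W) g :
  open A -> Ck k A g -> Ck k A (fun y => g y ^+ 2).
Proof. by move=> oA Cg; apply: Ck_mul. Qed.

Lemma Ck_kden k A b : open A -> Ck k A (@kden R n b).
Proof.
move=> oA; apply: Ck_add => //; last exact: Ck_cdot.
apply: Ck_mul => //; last exact: Ck_cst.
apply: Ck_sqr => //; apply: Ck_add => //; first exact: Ck_co.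
by apply: Ck_mul => //; [exact: Ck_cst|exact: Ck_co].
Qed.

Lemma Ck_kratio k (A : set V) b (N : V -> R) : open A ->
  (forall q, A q -> 0 < kden b q) -> Ck k A N ->
  Ck k A (fun q => N q / (Num.sqrt (1 + b ^+ 2) * Num.sqrt (kden b q))).
Proof.
move=> oA D0 CN; apply: Ck_mul => //; apply: Ck_inv => //.
  move=> q Aq; rewrite mulf_neq0 ?sqrt_onea2_neq0//.
  by rewrite gt_eqF ?sqrtr_gt0 ?D0.
apply: Ck_mul => //; first exact: Ck_cst.
by apply: Ck_sqrt => //; exact: Ck_kden.
Qed.

Lemma Ck_hratio k (A : set V) (N : V -> R) : open A ->
  (forall q, A q -> 0 < co q n.+1 ^+ 2) -> Ck k A N ->
  Ck k A (fun q => N q / co q n.+1 ^+ 2).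
Proof.
move=> oA z0 CN; apply: Ck_mul => //; apply: Ck_inv => //.
  by move=> q Aq; rewrite gt_eqF ?z0.
by apply: Ck_sqr => //; exact: Ck_co.
Qed.

Let oD := open_domain.

Lemma Ck_kforce k b : (forall q, force_domain q -> 0 < kden b q) -> Ck k force_domain (kforce b).
Proof.
move=> D0; apply: Ck_kratio => //; apply: Ck_add => //; last first.
  by apply: Ck_opp => //; exact: Ck_co.
by apply: Ck_mul => //; [exact: Ck_cst|exact: Ck_co].
Qed.

Lemma Ck_kconj k b : (forall q, force_domain q -> 0 < kden b q) -> Ck k force_domain (kconj b).
Proof. by move=> D0; apply: Ck_kratio => //; exact: Ck_co. Qed.

Lemma Ck_lforce k : Ck k force_domain lforce.
Proof.
apply: Ck_add => //; first apply: Ck_add => //.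
- by apply: Ck_weight => // m1; apply: Ck_kforce => q [_ /(_ m1)].
- by apply: Ck_weight => // m1; apply: Ck_kforce => q [_ _ /(_ m1)].
- apply: Ck_weight => // m1; apply: Ck_hratio => //.
    by move=> q [_ _ _ /(_ m1)].
  apply: Ck_add => //; last exact: Ck_cdot.
  by apply: Ck_sqr => //; exact: Ck_co.
Qed.

Lemma Ck_lconj k : Ck k force_domain lconj.
Proof.
apply: Ck_add => //; first apply: Ck_add => //.
- by apply: Ck_weight => // m1; apply: Ck_kconj => q [_ /(_ m1)].
- by apply: Ck_weight => // m1; apply: Ck_kconj => q [_ _ /(_ m1)].
- apply: Ck_opp => //; apply: Ck_weight => // m1; apply: Ck_hratio => //.
    by move=> q [_ _ _ /(_ m1)].
  apply: Ck_add => //; last exact: Ck_cdot.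
  apply: Ck_mul => //; last exact: Ck_cst.
  by apply: Ck_sqr => //; exact: Ck_co.
Qed.

Lemma smooth_force : smooth_near (regular S) (force S).
Proof.
exists force_domain; split=> //; first exact: regular_domain.
by move=> k; apply: Ck_eq (Ck_lforce k) => // q [q0 _ _ _]; rewrite force_lforce.
Qed.

Definition vdomain : set (V * V) := [set x | force_domain x.1].

Lemma open_vdomain : open vdomain.
Proof. exact: open_fst. Qed.

Lemma phase_domain : phase_space S `<=` vdomain.
Proof. by move=> x [/regular_domain]. Qed.

Lemma E_sphE x : E_sph a hm1 hm2 f x = 2^-1 * dot x.2 x.2 - force S x.1.
Proof.
have ct (c t : R) : c / tan t = c * cot t by rewrite /tan /cot invf_div.
rewrite /E_sph /= !ct dot_sum; under eq_bigr do rewrite expr2.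
by rewrite !opprD !addrA.
Qed.

Definition kinetic_sp x : R := 2^-1 * (angmom 1 x.1 x.2 ^+ 2 / (1 + a ^+ 2)
  + \sum_(2 <= i < n.+1) angmom i x.1 x.2 ^+ 2).

Lemma E_spE x : E_sp a hm1 hm2 f x = kinetic_sp x + lconj x.1.
Proof.
have rho : \sum_(2 <= i < n.+1) co x.1 i ^+ 2 = cdot n x.1 x.1.
  by apply: eq_bigr => i _; rewrite expr2.
have h : co x.1 1 ^+ 2 / ((1 + a ^+ 2) * co x.1 n.+1 ^+ 2)
    + \sum_(2 <= i < n.+1) co x.1 i ^+ 2 / co x.1 n.+1 ^+ 2 = hconj a x.1.
  by rewrite -mulr_suml rho /hconj invfM; ring.
rewrite /E_sp /= h rho /lconj /kconj /kden sqrrN mulNr /kinetic_sp /angmom /= !invfM.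
by ring.
Qed.

(** Lagrange's identity between squared minors and a Gram determinant, by induction on k. The
    right-hand side shows the rotation invariance. *)
Lemma C_hatE k x : C_hat k x
  = cdot k x.1 x.1 * cdot k x.2 x.2 - cdot k x.1 x.2 ^+ 2.
Proof.
case: k => [|k]; first by rewrite /C_hat /cdot !big_geq//; ring.
elim: k => [|k IH]; first by rewrite /C_hat /cdot !big_geq//; ring.
rewrite /C_hat big_nat_recr//= -/(C_hat k.+1 x) IH /cdot.
rewrite !(@big_nat_recr _ _ _ k.+2)//=.
rewrite -/(cdot _ x.1 x.1) -/(cdot _ x.2 x.2) -/(cdot _ x.1 x.2).
have -> : \sum_(2 <= i < k.+2)
      (co x.1 i * co x.2 k.+2 - co x.2 i * co x.1 k.+2) ^+ 2 =
    cdot k.+1 x.1 x.1 * co x.2 k.+2 ^+ 2 + cdot k.+1 x.2 x.2 * co x.1 k.+2 ^+ 2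
    - cdot k.+1 x.1 x.2 * (2 * co x.1 k.+2 * co x.2 k.+2).
  rewrite /cdot !mulr_suml -big_split -sumrB; apply: eq_bigr => i _ /=; ring.
by ring.
Qed.

Lemma is_diff_E_sph x : vdomain x -> is_diff x (E_sph a hm1 hm2 f)
  (fun w => dot x.2 w.2 - dlforce x.1 w.1).
Proof.
move=> xD; have -> : E_sph a hm1 hm2 f =
    (fun y => 2^-1 * dot y.2 y.2 - force S y.1).
  by apply/funext => y; rewrite E_sphE.
apply: is_diff_ext (is_diff_sub
  (is_diff_scale 2^-1 (is_diff_snd (is_diff_dot1 x.2)))
  (is_diff_fst (is_diff_force xD))) _ => w.
by rewrite mulKf.
Qed.

Definition dkinetic_sp x w : R :=
  angmom 1 x.1 x.2 * (angmom 1 x.1 w.2 + angmom 1 w.1 x.2) / (1 + a ^+ 2)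
  + \sum_(2 <= i < n.+1)
      angmom i x.1 x.2 * (angmom i x.1 w.2 + angmom i w.1 x.2).

Lemma is_diff_angmom i x : is_diff x (fun y : V * V => angmom i y.1 y.2)
  (fun w => angmom i x.1 w.2 + angmom i w.1 x.2).
Proof.
have c1 j := is_diff_fst (is_diff_co x.1 j) : is_diff x (fun y : V * V => co y.1 j) _.
have c2 j := is_diff_snd (is_diff_co x.2 j) : is_diff x (fun y : V * V => co y.2 j) _.
apply: is_diff_ext (is_diff_sub (is_diff_mul (c1 n.+1) (c2 i))
  (is_diff_mul (c1 i) (c2 n.+1))) _ => w.
by rewrite /angmom; ring.
Qed.

Lemma is_diff_kinetic_sp x : is_diff x kinetic_sp (dkinetic_sp x).
Proof.
apply: is_diff_ext (is_diff_scale 2^-1 (is_diff_add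
  (is_diff_mul (is_diff_sqr (is_diff_angmom 1 x)) (is_diff_const (1 + a ^+ 2)^-1 x))
  (is_diff_bigsum _ (fun i => is_diff_sqr (is_diff_angmom i x))))) _ => w.
rewrite /dkinetic_sp mulrDr mulr0 add0r; congr (_ + _); first by field; rewrite onea2_neq0.
by rewrite mulr_sumr; apply: eq_bigr => i _; field.
Qed.

Lemma is_diff_E_sp x : vdomain x -> is_diff x (E_sp a hm1 hm2 f)
  (fun w => dkinetic_sp x w + dlconj x.1 w.1).
Proof.
move=> xD; have -> : E_sp a hm1 hm2 f = (fun y => kinetic_sp y + lconj y.1).
  by apply/funext => y; rewrite E_spE.
exact: is_diff_add (is_diff_kinetic_sp x) (is_diff_fst (is_diff_lconj xD)).
Qed.

Definition dC_hat k x w : R :=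
  2 * (cdot k x.2 x.2 * cdot k x.1 w.1 + cdot k x.1 x.1 * cdot k x.2 w.2
       - cdot k x.1 x.2 * (cdot k x.1 w.2 + cdot k x.2 w.1)).

Lemma is_diff_cdot12 k x : is_diff x (fun y : V * V => cdot k y.1 y.2)
  (fun w => cdot k x.1 w.2 + cdot k x.2 w.1).
Proof.
apply: is_diff_ext (is_diff_bigsum _ (fun i =>
  is_diff_mul (is_diff_fst (is_diff_co x.1 i)) (is_diff_snd (is_diff_co x.2 i)))) _ => w.
by rewrite big_split.
Qed.

Lemma is_diff_C_hat k x : is_diff x (C_hat k) (dC_hat k x).
Proof.
have -> : C_hat k = (fun y : V * V =>
    cdot k y.1 y.1 * cdot k y.2 y.2 - cdot k y.1 y.2 ^+ 2).
  by apply/funext => y; rewrite C_hatE.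
apply: is_diff_ext (is_diff_sub (is_diff_mul (is_diff_fst (is_diff_cdot k x.1))
  (is_diff_snd (is_diff_cdot k x.2))) (is_diff_sqr (is_diff_cdot12 k x))) _ => w.
by rewrite /dC_hat; ring.
Qed.

Lemma Ck_co1 k A i : Ck k A (fun x : V * V => co x.1 i).
Proof. by apply: Ck_lin => x; exact: is_diff_fst (is_diff_co _ _). Qed.

Lemma Ck_co2 k A i : Ck k A (fun x : V * V => co x.2 i).
Proof. by apply: Ck_lin => x; exact: is_diff_snd (is_diff_co _ _). Qed.

Lemma Ck_angmom k (A : set (V * V)) i : open A ->
  Ck k A (fun x => angmom i x.1 x.2).
Proof.
by move=> oA; apply: Ck_add => //; [|apply: Ck_opp => //]; apply: Ck_mul => //;
  (exact: Ck_co1 || exact: Ck_co2).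
Qed.

Lemma smooth_E_sph : smooth_near (phase_space S) (E_sph a hm1 hm2 f).
Proof.
exists vdomain; split; [exact: open_vdomain|exact: phase_domain|move=> k].
apply: (@Ck_eq _ _ _ _ (fun x : V * V => 2^-1 *
    (\sum_(1 <= i < n.+2) co x.2 i * co x.2 i) - lforce x.1)).
- exact: open_vdomain.
- by move=> x [x0 _ _ _]; rewrite E_sphE force_lforce// dot_sum.
- have oP := open_vdomain; apply: Ck_add => //; last first.
    by apply: Ck_opp => //; apply: Ck_fst => //; exact: Ck_lforce.
  apply: Ck_mul => //; first exact: Ck_cst.
  by apply: Ck_sum => // i; apply: Ck_mul => //; exact: Ck_co2.
Qed.

Lemma smooth_E_sp : smooth_near (phase_space S) (E_sp a hm1 hm2 f).
Proof.
exists vdomain; split; [exact: open_vdomain|exact: phase_domain|move=> k].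
have oP := open_vdomain.
apply: (@Ck_eq _ _ _ _ (fun x : V * V => kinetic_sp x + lconj x.1)) => //.
  by move=> x _; rewrite E_spE.
apply: Ck_add => //; last by apply: Ck_fst => //; exact: Ck_lconj.
apply: Ck_mul => //; first exact: Ck_cst.
apply: Ck_add => //.
  apply: Ck_mul => //; last exact: Ck_cst.
  by apply: Ck_sqr => //; exact: Ck_angmom.
by apply: Ck_sum => // i; apply: Ck_sqr => //; exact: Ck_angmom.
Qed.

Lemma smooth_C_hat l : smooth_near (phase_space S) (C_hat l).
Proof.
exists vdomain; split; [exact: open_vdomain|exact: phase_domain|move=> k].
have oP := open_vdomain.
apply: Ck_sum => // j; apply: Ck_sum => // i; apply: Ck_sqr => //.
by apply: Ck_add => //; [|apply: Ck_opp => //]; apply: Ck_mul => //;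
  (exact: Ck_co1 || exact: Ck_co2).
Qed.

End Lagrange.

(** * Involution *)

Section Involution.
Context {R : realType} {n : nat} (a hm1 hm2 f : R).
Notation V := 'rV[R]_n.+1.
Context (hn : (2 <= n)%N).
Implicit Types (q u v : V) (x w : V * V).
Notation S := (lagrange_problem n a hm1 hm2 f).

Let n0 : (0 < n)%N. Proof. exact: leq_trans hn. Qed.

Definition restr k u : V := vec (fun i => if (2 <= i <= k)%N then co u i else 0).

Lemma co_restr k u i : (0 < i <= n.+1)%N ->
  co (restr k u) i = if (2 <= i <= k)%N then co u i else 0.
Proof. exact: co_vec. Qed.

Lemma co_restr1 k u : co (restr k u) 1 = 0.
Proof. by rewrite co_restr. Qed.

Lemma co_restrN k u : (k <= n)%N -> co (restr k u) n.+1 = 0.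
Proof. by move=> kn; rewrite co_restr ?leqnn// [(n < k)%N]ltnNge kn andbF. Qed.

Lemma cdot_restr l k u v : (k <= l <= n)%N -> cdot l u (restr k v) = cdot k u v.
Proof.
move=> /andP[kl ln]; rewrite /cdot (big_nat_widen 2 k.+1 l.+1)// [RHS]big_mkcond/=.
apply: eq_big_nat => i /andP[i2 il]; rewrite co_restr; last first.
  by rewrite (ltnW i2)/= (leq_trans (ltnW il)).
by rewrite i2 ltnS/=; case: leqP => _; rewrite ?mulr0.
Qed.

Lemma dot_restr k u v : (k <= n)%N -> dot u (restr k v) = cdot k u v.
Proof.
move=> kn; rewrite dot_cdot// co_restr1 co_restrN// cdot_restr ?kn ?leqnn//.
by rewrite !mulr0 add0r addr0.
Qed.

(** The images of q and v under one skew map, u |-> 2 ((q.u) v - (v.u) q) on the coordinates 2, ...,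
    k; skewness makes the field tangent to TS^n. *)
Definition rotation_field k x : V * V :=
  (2 *: (cdot k x.1 x.1 *: restr k x.2 - cdot k x.1 x.2 *: restr k x.1),
   2 *: (cdot k x.1 x.2 *: restr k x.2 - cdot k x.2 x.2 *: restr k x.1)).

Lemma hamiltonian_C_hat k x : (k <= n)%N ->
  is_hamiltonian_vector (C_hat k) x (rotation_field k x).
Proof.
move=> kn; split.
  split; rewrite /= !dotE !dot_restr// ?(cdotC k x.2 x.1); ring.
move=> w _; have [_ ->] := is_diff_C_hat k x.
rewrite /omega/= !dotE ![dot (restr _ _) _]dotC !dot_restr// /dC_hat.
by rewrite ![cdot k w.2 _]cdotC ![cdot k w.1 _]cdotC; ring.
Qed.

(** The part of an infinitesimal rotation that the integrals see: q_1, q_(n+1), v_1, v_(n+1) and the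
    three scalar products of q and v over 2, ..., n are stationary. *)
Definition rotational x w :=
  [/\ co w.1 1 = 0, co w.1 n.+1 = 0, co w.2 1 = 0 & co w.2 n.+1 = 0] /\
  [/\ cdot n x.1 w.1 = 0, cdot n x.2 w.2 = 0
    & cdot n x.2 w.1 + cdot n x.1 w.2 = 0].

Lemma rotation_field_rotational k x : (k <= n)%N -> rotational x (rotation_field k x).
Proof.
move=> kn; split; split; rewrite /rotation_field/= ?coE ?cdotE.
- by rewrite !co_restr1; ring.
- by rewrite !co_restrN//; ring.
- by rewrite !co_restr1; ring.
- by rewrite !co_restrN//; ring.
- by rewrite !cdot_restr ?kn ?leqnn//; ring.
- by rewrite !cdot_restr ?kn ?leqnn// (cdotC k x.2 x.1); ring.
- by rewrite !cdot_restr ?kn ?leqnn// (cdotC k x.2 x.1); ring.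
Qed.

Lemma dlforce_rotational x w : rotational x w -> dlforce a hm1 hm2 f x.1 w.1 = 0.
Proof.
move=> [[w1 wN _ _] [qw _ _]].
by rewrite /dlforce /dkforce /dhforce /dkden w1 wN qw; ring.
Qed.

Lemma dlconj_rotational x w : rotational x w -> dlconj a hm1 hm2 f x.1 w.1 = 0.
Proof.
move=> [[w1 wN _ _] [qw _ _]].
by rewrite /dlconj /dkconj /dhconj /dkden w1 wN qw; ring.
Qed.

Lemma dkinetic_sp_rotational x w : rotational x w -> dkinetic_sp a x w = 0.
Proof.
move=> [[w1 wN v1 vN] [qw vw vqw]].
rewrite /dkinetic_sp {2 3}/angmom w1 wN v1 vN.
(* Expanded, the sum is a combination of the variations of the three scalar products. *)
rewrite (eq_bigr (fun i =>
    co x.1 n.+1 ^+ 2 * (co x.2 i * co w.2 i) + co x.2 n.+1 ^+ 2 * (co x.1 i * co w.1 i)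
    - co x.1 n.+1 * co x.2 n.+1 * (co x.2 i * co w.1 i + co x.1 i * co w.2 i))).
  rewrite sumrB big_split -!mulr_sumr big_split/= -!/(cdot _ _ _) qw vw vqw.
  by ring.
by move=> i _; rewrite /angmom wN vN; ring.
Qed.

Lemma bracket_C_hat_E_sph k x : (k <= n)%N -> phase_space S x ->
  poisson_bracket (C_hat k) (E_sph a hm1 hm2 f) x = 0.
Proof.
move=> kn Sx; have [[q1 _] qv] := Sx.
rewrite (bracket_hamiltonian _ q1 qv (hamiltonian_C_hat x kn)).
have rot := rotation_field_rotational x kn.
have [_ ->] := is_diff_E_sph hn (phase_domain hn Sx).
rewrite (dlforce_rotational rot) subr0; have [[w1 wN v1 vN] [_ vw _]] := rot.
by rewrite dot_cdot// vw v1 vN; ring.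
Qed.

Lemma bracket_C_hat_E_sp k x : (k <= n)%N -> phase_space S x ->
  poisson_bracket (C_hat k) (E_sp a hm1 hm2 f) x = 0.
Proof.
move=> kn Sx; have [[q1 _] qv] := Sx.
rewrite (bracket_hamiltonian _ q1 qv (hamiltonian_C_hat x kn)).
have rot := rotation_field_rotational x kn.
have [_ ->] := is_diff_E_sp (phase_domain hn Sx).
by rewrite (dlconj_rotational rot) (dkinetic_sp_rotational rot) addr0 oppr0.
Qed.

(** A rotation of the coordinates 2, ..., k preserves the scalar products over 2, ..., l when k <=
    l; antisymmetry gives the other case. *)
Lemma bracket_C_hat k l x : (k <= n)%N -> (l <= n)%N -> phase_space S x ->
  poisson_bracket (C_hat k) (C_hat l) x = 0.
Proof.
wlog kl : k l / (k <= l)%N.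
  move=> H kn ln Sx; case/orP: (leq_total k l) => kl; first exact: H.
  by rewrite bracketC H// oppr0.
move=> kn ln Sx; have [[q1 _] qv] := Sx.
rewrite (bracket_hamiltonian _ q1 qv (hamiltonian_C_hat x kn)).
have [_ ->] := is_diff_C_hat l x.
rewrite /dC_hat /rotation_field/= !cdotE !cdot_restr ?kl// (cdotC k x.2 x.1).
by ring.
Qed.

Lemma kepler_duality_weight m b q v : dot q q = 1 -> (m <> 0 -> 0 < kden b q) ->
  angmom 1 q v * (m * dkforce b q (polar 1 q)) / (1 + b ^+ 2)
  + \sum_(2 <= i < n.+1) angmom i q v * (m * dkforce b q (polar i q))
  + m * dkconj b q v = 0.
Proof.
move=> q1 D0; have [->|/eqP/D0 m0] := eqVneq m 0.
  by rewrite big1 => [|i _]; ring.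
have := congr1 ( *%R m) (kepler_duality hn q1 v m0).
rewrite mulr0 !mulrDr mulr_sumr => E; rewrite -[RHS]E.
congr (_ + _ + _); first by ring.
by apply: eq_bigr => i _; ring.
Qed.

Lemma hooke_duality_weight q v : dot q q = 1 -> (f <> 0 -> 0 < co q n.+1 ^+ 2) ->
  angmom 1 q v * (f * dhforce q (polar 1 q)) / (1 + a ^+ 2)
  + \sum_(2 <= i < n.+1) angmom i q v * (f * dhforce q (polar i q))
  = f * dhconj a q v.
Proof.
move=> q1 z0; have [->|/eqP/z0] := eqVneq f 0.
  by rewrite big1 => [|i _]; ring.
rewrite sqr_gt0 => /(hooke_duality hn q1 a v) <-; rewrite [RHS]mulrDr mulr_sumr.
congr (_ + _); first by ring.
by apply: eq_bigr => i _; ring.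
Qed.

Lemma lagrange_duality q v : dot q q = 1 -> force_domain a hm1 hm2 f q ->
  angmom 1 q v * dlforce a hm1 hm2 f q (polar 1 q) / (1 + a ^+ 2)
  + \sum_(2 <= i < n.+1) angmom i q v * dlforce a hm1 hm2 f q (polar i q)
  + dlconj a hm1 hm2 f q v = 0.
Proof.
move=> q1 [_ h1 h2 h3].
have E1 := kepler_duality_weight v q1 h1.
(* The kinetic form involves a only through a^2, which is why it serves both centers. *)
have E2 := kepler_duality_weight v q1 h2; rewrite sqrrN in E2.
have E3 := hooke_duality_weight v q1 h3.
rewrite (eq_bigr (fun i => angmom i q v * (hm1 * dkforce a q (polar i q))
   + angmom i q v * (hm2 * dkforce (- a) q (polar i q))
   + angmom i q v * (f * dhforce q (polar i q)))); last first.
  by move=> i _; rewrite /dlforce; ring.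
rewrite !big_split/= /dlconj -E3 /dlforce; move: E1 E2.
set s1 := \sum_(_ <= _ < _) _; set s2 := \sum_(_ <= _ < _) _.
set s3 := \sum_(_ <= _ < _) _ => E1 E2.
by rewrite -[RHS](addr0 0) -{1}E1 -E2; ring.
Qed.

(* Evaluating omega X on (0, w) and on (polar i q, .) determines what is needed
   of the Hamiltonian vector without a formula for the gradient of the force. *)
Lemma hamiltonian_E_sph x X : phase_space S x ->
  is_hamiltonian_vector (E_sph a hm1 hm2 f) x X ->
  X.1 = x.2 /\
  forall i, (0 < i <= n)%N -> angmom i x.1 X.2 = dlforce a hm1 hm2 f x.1 (polar i x.1).
Proof.
move=> Sx [[qX vqX] eX]; have [[q1 _] qv] := Sx.
have {}eX w : tangent2 x w -> omega X w = dot x.2 w.2 - dlforce a hm1 hm2 f x.1 w.1.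
  by move=> /eX ->; have [_ ->] := is_diff_E_sph hn (phase_domain hn Sx).
have dlforce0 : dlforce a hm1 hm2 f x.1 0 = 0.
  by rewrite /dlforce /dkforce /dhforce /dkden !co0 cdot0r; ring.
have X1 : X.1 = x.2.
  apply: subr0_eq; apply: dot_eq0.
  (* Tested on this vertical vector, the equation says that X.1 - x.2 is orthogonal to itself. *)
  have := eX (0, X.1 - x.2); rewrite /omega/= dlforce0 subr0 dot0r.
  rewrite /tangent2/= !dot0r subr0 dotDr dotNr qX (qv : dot _ _ = 0) subrr addr0.
  by move=> /(_ (conj erefl erefl)) E; rewrite dotDl dotNl E subrr.
split=> // i /andP[i0 iN].
have qp : dot x.1 (polar i x.1) = 0.
  rewrite /polar !dotE !dot_evec ?leqnn//; first by ring.
  by rewrite i0 leqW.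
(* The multiple of q makes the pair tangent, and contributes nothing because q is orthogonal to
   v. *)
have := eX (polar i x.1, - dot x.2 (polar i x.1) *: x.1).
rewrite /omega/= X1 !dotZr [dot x.2 x.1]dotC (qv : dot _ _ = 0) mulr0 !sub0r.
move=> /(_ _)/oppr_inj <-; last by split; rewrite //= dotZr (q1 : dot _ _ = 1) mulr1 subrr.
rewrite /polar !dotE !dot_evec ?leqnn ?i0 ?leqW//.
Qed.

(** Since [angmom i v v] is 0, only the force changes [angmom i] along the Hamiltonian vector, and
    the bracket becomes the left-hand side of [lagrange_duality]. *)
Lemma bracket_E_sph_E_sp x : phase_space S x ->
  poisson_bracket (E_sph a hm1 hm2 f) (E_sp a hm1 hm2 f) x = 0.
Proof.
move=> Sx; have [[q1 _] qv] := Sx.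
have [X hX] := hamiltonian_vector_exists (E_sph a hm1 hm2 f) q1 qv.
rewrite (bracket_hamiltonian _ q1 qv hX).
have [X1 X2] := hamiltonian_E_sph Sx hX.
have [_ ->] := is_diff_E_sp (phase_domain hn Sx).
have am i : angmom i x.2 x.2 = 0 by rewrite /angmom; ring.
rewrite X1 /dkinetic_sp X1 am addr0 X2 ?n0//.
rewrite (eq_big_nat _ _ (F2 := fun i =>
  angmom i x.1 x.2 * dlforce a hm1 hm2 f x.1 (polar i x.1))); last first.
  by move=> i /andP[i2 iN]; rewrite am addr0 X2// (ltnW i2).
by rewrite lagrange_duality ?oppr0//; exact: phase_domain hn _ Sx.
Qed.

End Involution.

(** * Functional independence *)

Section Independence.
Context {R : realType} {n : nat} (a hm1 hm2 f : R).
Notation V := 'rV[R]_n.+1.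
Context (hn : (3 <= n)%N).
Implicit Types (q u v : V) (x w : V * V).
Notation S := (lagrange_problem n a hm1 hm2 f).

Let n2 : (2 <= n)%N. Proof. exact: ltnW. Qed.

(** These are the pivots of the elimination in [generic_independent]. Up to sign, the product of the
    first two is the determinant of the system for the coefficients of [E_sph], [E_sp] and
    [C_hat n]; the others remove the remaining [C_hat]. *)
Definition generic x : Prop :=
  let q := x.1 in let v := x.2 in
  [/\ co q n.+1 != 0,
      cdot n q q * co v 1 * co v n.+1
      - cdot n q v * (co q n.+1 * co v 1 - angmom 1 q v / (1 + a ^+ 2)) != 0
    & forall k, (2 <= k < n)%N ->
      cdot k q q * co v k.+1 - cdot k q v * co q k.+1 != 0].

(* Kepler and Hooke forces do not contribute to the derivatives along the
   fibres, so that independence is that of the kinetic parts. *)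
Lemma d_integral_fibre x u : phase_space S x -> forall i : 'I_n,
  'd (lagrange_integrals a hm1 hm2 f i) x (0, u) =
  match val i with
  | 0 => dot x.2 u
  | 1 => angmom 1 x.1 x.2 * angmom 1 x.1 u / (1 + a ^+ 2)
         + \sum_(2 <= i < n.+1) angmom i x.1 x.2 * angmom i x.1 u
  | k.+2 => 2 * (cdot k.+3 x.1 x.1 * cdot k.+3 x.2 u
                 - cdot k.+3 x.1 x.2 * cdot k.+3 x.1 u)
  end.
Proof.
move=> Sx i; have xD := phase_domain n2 Sx; rewrite /lagrange_integrals.
case: (val i) => [|[|k]].
- have [_ ->] := is_diff_E_sph n2 xD.
  by rewrite /dlforce /dkforce /dhforce /dkden !co0 cdot0r; ring.
- have [_ ->] := is_diff_E_sp xD.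
  rewrite /dlconj /dkconj /dhconj /dkden !co0 cdot0r /dkinetic_sp /=.
  have am0 j : angmom j (0 : V) x.2 = 0 by rewrite /angmom !co0; ring.
  rewrite am0 addr0; under eq_bigr do rewrite am0 addr0.
  by ring.
- have [_ ->] := is_diff_C_hat k.+3 x.
  by rewrite /dC_hat/= !cdot0r; ring.
Qed.

Lemma generic_independent x : phase_space S x -> generic x ->
  independent_at (lagrange_integrals a hm1 hm2 f) x.
Proof.
move=> Sx [z0 D0 C0] c cF.
have [[q1 _] qv] := Sx.
have {}q1 : dot x.1 x.1 = 1 by []. have {}qv : dot x.1 x.2 = 0 by [].
(* Coefficients indexed by naturals, with default 0, so that sums run over intervals. *)
pose b (i : nat) : R := if insub i is Some j then c j else 0.
have bE (i : 'I_n) : b i = c i by rewrite /b valK.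
suff b0 : forall i, (i < n)%N -> b i = 0 by move=> i; rewrite -bE b0.
set q := x.1 in z0 D0 C0 q1 qv; set v := x.2 in D0 C0 qv.
have L u : dot q u = 0 -> b 0%N * dot v u
    + b 1%N * (angmom 1 q v * angmom 1 q u / (1 + a ^+ 2)
       + \sum_(2 <= i < n.+1) angmom i q v * angmom i q u)
    + \sum_(2 <= i < n) b i * (2 * (cdot i.+1 q q * cdot i.+1 v u
                 - cdot i.+1 q v * cdot i.+1 q u)) = 0.
  move=> qu; have T : tangent2 x (0, u).
    by split; rewrite /= !dot0r// qu addr0.
  have := cF _ T; pose G (i : nat) := match i with
    | 0 => dot v u
    | 1 => angmom 1 q v * angmom 1 q u / (1 + a ^+ 2)
           + \sum_(2 <= i < n.+1) angmom i q v * angmom i q u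
    | k.+2 => 2 * (cdot k.+3 q q * cdot k.+3 v u
                   - cdot k.+3 q v * cdot k.+3 q u)
    end.
  rewrite (eq_bigr (fun i : 'I_n => b i * G i)); last first.
    by move=> i _; rewrite d_integral_fibre// bE.
  rewrite -(big_mkord xpredT (fun i => b i * G i)).
  rewrite big_ltn 1?(leq_trans _ hn)// big_ltn 1?(leq_trans _ hn)// addrA => E.
  rewrite -[RHS]E.
  by congr (_ + _); apply: eq_big_nat => -[|[|i]].
have {L} Le j : (0 < j <= n.+1)%N -> b 0%N * co v j
    + b 1%N * (angmom 1 q v * angmom 1 q (evec j) / (1 + a ^+ 2)
       + \sum_(2 <= i < n.+1) angmom i q v * angmom i q (evec j))
    + \sum_(2 <= i < n) b i * (2 * (cdot i.+1 q q * cdot i.+1 v (evec j)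
                 - cdot i.+1 q v * cdot i.+1 q (evec j))) = 0.
  move=> jn; have := L (evec j - co q j *: q).
  rewrite dotDr dotNr dotZr q1 dot_evec// mulr1 subrr => /(_ erefl).
  rewrite dotDr dotNr dotZr [dot v q]dotC qv mulr0 subr0 dot_evec//.
  have am i : angmom i q (evec j - co q j *: q) = angmom i q (evec j).
    by rewrite /angmom !coE; ring.
  rewrite am => E; rewrite -[RHS]E; congr (_ + _ * (_ + _) + _); apply: eq_bigr => i _.
    by rewrite am.
  by rewrite !cdotE (cdotC _ v q); ring.
have cde i u j : (2 <= i < n)%N -> (2 <= j <= n)%N ->
    cdot i.+1 u (evec j) = if (j <= i.+1)%N then co u j else 0.
  move=> /andP[_ iN] /andP[j2 jN].
  by rewrite cdot_evec// ?j2 leqW.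
(* Testing the relation on e_j, 2 <= j <= n, gives A j * v_j = B j * q_j.  As A
   and B agree at 2 and 3, they vanish there, and the differences A j.+1 - A j
   then kill the coefficients of the C_hat one after the other. *)
pose s (g : nat -> R) j := \sum_(2 <= i < n) (if (j <= i.+1)%N then b i * g i.+1 else 0).
pose A j := b 0%N + b 1%N * co q n.+1 ^+ 2 + 2 * s (fun k => cdot k q q) j.
pose B j := b 1%N * co q n.+1 * co v n.+1 + 2 * s (fun k => cdot k q v) j.
have AB j : (2 <= j <= n)%N -> A j * co v j = B j * co q j.
  move=> jn; have /andP[j2 jn'] := jn.
  have := Le j; rewrite (ltnW j2) (leqW jn') => /(_ isT).
  have amj i : (0 < i <= n)%N -> angmom i q (evec j) = co q n.+1 * (i == j)%:R.
    move=> /andP[i0 iN]; rewrite /angmom !co_evec ?leqnn// ?i0 ?leqW//.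
    by rewrite (gtn_eqF (_ : j < n.+1)%N)//= mulr0 subr0.
  rewrite amj ?(leq_trans _ hn)// (ltn_eqF j2) mulr0 mulr0 mul0r add0r.
  rewrite (bigD1_seq j) ?iota_uniq ?mem_index_iota ?j2//= amj ?(ltnW j2)// eqxx mulr1.
  rewrite big_seq_cond big1 ?addr0; last first.
    move=> i /andP[]; rewrite mem_index_iota => /andP[i2 iN] ij.
    by rewrite amj ?(ltnW i2)// (negPf ij) mulr0 mulr0.
  rewrite (eq_big_nat _ _ (F2 := fun i =>
    2 * co v j * (if (j <= i.+1)%N then b i * cdot i.+1 q q else 0)
    - 2 * co q j * (if (j <= i.+1)%N then b i * cdot i.+1 q v else 0))); last first.
    by move=> i iN; rewrite !cde//; case: leqP => _; ring.
  rewrite sumrB -!mulr_sumr -!/(s _ j) /A /B /angmom => /eqP E.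
  apply/eqP; rewrite -subr_eq0 -(eqP E); apply/eqP.
  rewrite /s; ring.
have n0 : (0 < n)%N by exact: ltnW n2.
have N1 : (1%N == n.+1) = false by rewrite ltn_eqF// ltnS (ltnW n2).
have N1' : (n.+1 == 1)%N = false by rewrite eq_sym.
(* On e_1 neither the [C_hat] nor [angmom i] with i >= 2 contribute. *)
have E1 : b 0%N * co v 1 + b 1%N * (angmom 1 q v * co q n.+1 / (1 + a ^+ 2)) = 0.
  have := Le 1%N isT; rewrite big_nat_cond big1 ?addr0; last first.
    move=> i /andP[/andP[i2 iN] _]; rewrite /angmom !co_evec ?leqnn ?(ltnW i2) ?leqW//.
    by rewrite (gtn_eqF i2) N1' /= !mulr0 subrr mulr0.
  rewrite big_nat_cond big1 ?addr0; last first.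
    move=> i /andP[/andP[i2 iN] _]; rewrite !cdot_evec1 ?leqW//.
    by rewrite !mulr0 subrr !mulr0.
  rewrite {2}/angmom !co_evec ?leqnn//.
  by rewrite eqxx N1' /= mulr0 subr0 mulr1.
(* For k = 2 the pivot factors as q_2 (q_2 v_3 - q_3 v_2). *)
have C2 : co q 2 * co v 3 - co q 3 * co v 2 != 0 /\ co q 2 != 0.
  have := C0 2%N; rewrite hn => /(_ isT).
  rewrite /cdot !big_nat1 => H; split; apply: contraNneq H => e.
    by rewrite -mulrA -mulrA -mulrBr [co v 2 * _]mulrC e mulr0.
  by rewrite e !mul0r subrr.
have n3 : (2 <= 3 <= n)%N by []. have n2' : (2 <= 2 <= n)%N by [].
(* The family starts with [C_hat 3], so the coordinates 2 and 3 occur in the same integrals. *)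
have s23 g : s g 3%N = s g 2%N.
  by apply: eq_big_nat => i /andP[i2 _]; rewrite !ltnS i2 (ltnW i2).
have AB2 := AB _ n2'. have := AB _ n3; rewrite /A /B !s23 -/(A 2%N) -/(B 2%N) => AB3.
have A0 : A 2%N = 0.
  have [H _] := C2; apply: (mulIf H); rewrite mul0r.
  transitivity (co q 2 * (A 2%N * co v 3) - co q 3 * (A 2%N * co v 2)); first by ring.
  by rewrite AB2 AB3; ring.
have B0 : B 2%N = 0.
  by have [_ H] := C2; apply: (mulIf H); rewrite mul0r -AB2 A0 mul0r.
have bz i : (2 <= i)%N -> (i.+1 < n)%N -> b i = 0.
  elim/ltn_ind: i => i IH i2 iN.
  (* Going from 2 to i + 2 drops the summands of index at most i, all of which but the last vanish
     by induction. *)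
  have sE g : s g i.+2 = s g 2%N - b i * g i.+1.
    apply/eqP; rewrite eq_sym subr_eq; apply/eqP; rewrite /s.
    rewrite (bigD1_seq i) ?iota_uniq ?mem_index_iota ?i2 ?(ltnW iN)//= (leqW i2) addrC.
    congr (_ + _).
    rewrite [RHS](bigD1_seq i) ?iota_uniq ?mem_index_iota ?i2 ?(ltnW iN)//= ltnn add0r.
    rewrite big_seq_cond [RHS]big_seq_cond; apply: eq_bigr => l.
    rewrite mem_index_iota => /andP[/andP[l2 lN] li]; rewrite (leqW l2) !ltnS.
    case: ltngtP li => // li _; rewrite IH ?mul0r//.
    exact: leq_ltn_trans li (ltnW iN).
  have i2n : (2 <= i.+2 <= n)%N by [].
  have Ai : A i.+2 = - (2 * b i * cdot i.+1 q q).
    by rewrite -[RHS]add0r -A0 /A sE; ring.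
  have Bi : B i.+2 = - (2 * b i * cdot i.+1 q v).
    by rewrite -[RHS]add0r -B0 /B sE; ring.
  have Ci : cdot i.+1 q q * co v i.+2 - cdot i.+1 q v * co q i.+2 != 0.
    by apply: C0; rewrite iN (leqW i2).
  apply: (mulIf Ci); rewrite mul0r; apply: (@mulfI _ (-2)).
    by rewrite oppr_eq0 pnatr_eq0.
  by rewrite mulr0 -(subrr (B i.+2 * co q i.+2)) -{1}(AB _ i2n) Ai Bi; ring.
have sl g : s g 2%N = b n.-1 * g n.
  have np : n = n.-1.+1 by rewrite prednK// (leq_trans _ hn).
  rewrite /s {1}np big_nat_recr /= -?np; last by rewrite -ltnS -np.
  rewrite (leq_trans _ hn)// big_nat_cond big1 ?add0r// => i /andP[/andP[i2 iN] _].
  by rewrite bz ?mul0r ?if_same// np ltnS.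
(* Three coefficients are left, with the linear equations [A0], [B0] and [E1]; the combinations
   below are Cramer's rule. *)
move: A0 B0; rewrite /A /B !sl => A0 B0.
set g := b n.-1 in A0 B0.
set r := cdot n q q in A0 D0; set sg := cdot n q v in B0 D0.
set P := angmom 1 q v in E1 D0.
have b1 : b 1%N = 0.
  apply: (mulIf D0); apply: (mulIf z0); rewrite !mul0r.
  transitivity (r * co v 1 * (b 1%N * co q n.+1 * co v n.+1 + 2 * (g * sg))
    + sg * (b 0%N * co v 1 + b 1%N * (P * co q n.+1 / (1 + a ^+ 2)))
    - sg * co v 1 * (b 0%N + b 1%N * co q n.+1 ^+ 2 + 2 * (g * r))); first by ring.
  by rewrite A0 B0 E1; ring.
have g0 : g = 0.
  apply: (mulIf D0); apply: (@mulfI _ 2); rewrite ?pnatr_eq0// mul0r mulr0.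
  move: A0 B0 E1; rewrite b1 !mul0r !addr0 !add0r => A0 B0 E1.
  transitivity ((b 0%N + 2 * (g * r)) * co v 1 * co v n.+1 - (b 0%N * co v 1) * co v n.+1
   - 2 * (g * sg) * (co q n.+1 * co v 1 - P / (1 + a ^+ 2))); first by ring.
  by rewrite A0 B0 E1; ring.
have b00 : b 0%N = 0 by rewrite -A0 b1 g0; ring.
move=> [|[|i]]// iN; case: (ltngtP i.+3 n) => [iN'|iN'|e]; first exact: bz.
  by move: iN; rewrite ltnNge -ltnS iN'.
by rewrite -g0 /g -e.
Qed.

End Independence.

(** * Genericity as a polynomial condition *)

Section GenericPolynomial.
Context (n : nat).

(** [cdot] over an arbitrary ring, used both over R and over polynomials in the parameter of a
    line. *)
Definition psum (T : comNzRingType) k (q v : nat -> T) : T :=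
  \sum_(2 <= i < k.+1) q i * v i.

(** The product of the quantities in [generic], with b = 1 + a^2 and the denominator cleared. *)
Definition gpoly (T : comNzRingType) (b : T) (q v : nat -> T) : T :=
  q n.+1 * (b * (psum n q q * v 1%N * v n.+1 - psum n q v * (q n.+1 * v 1%N))
            + psum n q v * (q n.+1 * v 1%N - q 1%N * v n.+1))
  * \prod_(2 <= k < n) (psum k q q * v k.+1 - psum k q v * q k.+1).

(* |q|^2 times the orthogonal projection of v onto the hyperplane q^perp. *)
Definition pproj (T : comNzRingType) (q v : nat -> T) (i : nat) : T :=
  (\sum_(1 <= j < n.+2) q j * q j) * v i - (\sum_(1 <= j < n.+2) q j * v j) * q i.

Lemma rmorph_gpoly (T T' : comNzRingType) (phi : {rmorphism T -> T'}) b q v :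
  phi (gpoly b q v) = gpoly (phi b) (phi \o q) (phi \o v).
Proof.
have ps k (g h : nat -> T) : phi (psum k g h) = psum k (phi \o g) (phi \o h).
  by rewrite rmorph_sum; apply: eq_bigr => i _; rewrite rmorphM.
rewrite /gpoly !(rmorphM, rmorphD, rmorphN) !ps rmorph_prod; congr (_ * _).
by apply: eq_bigr => i _; rewrite rmorphB !rmorphM !ps.
Qed.

Lemma rmorph_pproj (T T' : comNzRingType) (phi : {rmorphism T -> T'}) q v i :
  phi (pproj q v i) = pproj (phi \o q) (phi \o v) i.
Proof.
rewrite /pproj rmorphB !rmorphM !rmorph_sum.
by congr (_ * _ - _ * _); apply: eq_bigr => j _; rewrite rmorphM.
Qed.

(** Normalising a point of TS^n takes a square root and a quotient; by homogeneity the condition can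
    be tested on unnormalised, polynomial data. *)
Lemma gpoly_scale (T : comNzRingType) (b k m : T) q v :
  gpoly b (fun i => k * q i) (fun i => m * v i)
  = k ^+ 3 * m ^+ 2 * (\prod_(2 <= i < n) (k ^+ 2 * m)) * gpoly b q v.
Proof.
have ps l (c d : T) (g h : nat -> T) :
    psum l (fun i => c * g i) (fun i => d * h i) = c * d * psum l g h.
  by rewrite /psum mulr_sumr; apply: eq_bigr => i _; ring.
rewrite /gpoly !ps (eq_bigr (fun l => (k ^+ 2 * m) *
  (psum l q q * v l.+1 - psum l q v * q l.+1))); last first.
  by move=> l _; rewrite !ps; ring.
by rewrite big_split/=; ring.
Qed.

Lemma gpoly_ext (T : comNzRingType) (b : T) q q' v v' :
  (forall i, (0 < i <= n.+1)%N -> q i = q' i) ->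
  (forall i, (0 < i <= n.+1)%N -> v i = v' i) ->
  (0 < n)%N -> gpoly b q v = gpoly b q' v'.
Proof.
move=> qq vv n0.
have ps k (g g' h h' : nat -> T) : (forall i, (0 < i <= n.+1)%N -> g i = g' i) ->
    (forall i, (0 < i <= n.+1)%N -> h i = h' i) -> (k <= n)%N ->
    psum k g h = psum k g' h'.
  move=> gg hh kn; apply: eq_big_nat => i /andP[i2 ik].
  by rewrite gg ?hh// (ltnW i2) (leq_trans (ltnW ik)).
rewrite /gpoly !qq ?vv ?leqnn// (ps n q q' q q')// (ps n q q' v v')//.
congr (_ * _); apply: eq_big_nat => k /andP[k2 kn].
by rewrite (ps k q q' q q') ?(ps k q q' v v') ?qq ?vv// ltnW// ltnW.
Qed.

End GenericPolynomial.

(** * Density of the generic points in the phase space *)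

Section Density.
Context {R : realType} {n : nat} (a hm1 hm2 f : R).
Notation V := 'rV[R]_n.+1.
Context (hn : (3 <= n)%N).
Implicit Types (q u v : V) (x w : V * V).
Notation S := (lagrange_problem n a hm1 hm2 f).

Let n2 : (2 <= n)%N. Proof. exact: ltnW. Qed.

(* A point at which the genericity polynomial does not vanish. *)
Definition qgen (i : nat) : R := [|| i == 1%N, i == 2%N | i == n.+1]%:R.
Definition vgen (i : nat) : R :=
  if i == n.+1 then -1 else if i == 2%N then 0 else 1.

Lemma psum_gen k g : (2 <= k <= n)%N -> psum k qgen g = g 2%N.
Proof.
move=> /andP[k2 kn]; rewrite /psum big_ltn// big_nat_cond big1 ?addr0.
  by rewrite /qgen/= mul1r.
move=> i /andP[/andP[i3 ik] _]; rewrite /qgen (gtn_eqF i3) (gtn_eqF (ltnW i3)).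
by rewrite (ltn_eqF (leq_trans ik _))// mul0r.
Qed.

(** [vgen] is orthogonal to [qgen], whose squared norm is 3, so [pproj] multiplies it by 3. Sums
    over 2, ..., k see only the coordinate 2 of [qgen]; each factor of the product is 3. *)
Lemma gpoly_gen_neq0 : gpoly n (1 + a ^+ 2) qgen (pproj n qgen vgen) != 0.
Proof.
have E1 : qgen 1 = 1 by [].
have E2 : qgen 2 = 1 by [].
have EN : qgen n.+1 = 1 by rewrite /qgen eqxx !orbT.
have V1 : vgen 1 = 1 by rewrite /vgen ltn_eqF// ltnS (ltnW n2).
have V2 : vgen 2 = 0 by rewrite /vgen ltn_eqF// ltnS.
have VN : vgen n.+1 = -1 by rewrite /vgen eqxx.
have sumE g : \sum_(1 <= j < n.+2) qgen j * g j = g 1%N + g 2%N + g n.+1.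
  rewrite big_ltn// big_nat_recr/= ?(leqW n2)// E1 EN !mul1r addrA.
  by rewrite -/(psum n qgen g) psum_gen ?n2 ?leqnn.
have pE i : pproj n qgen vgen i = 3 * vgen i.
  by rewrite /pproj !sumE E1 E2 EN V1 V2 VN; ring.
rewrite /gpoly !psum_gen ?n2 ?leqnn// !pE E1 E2 EN V1 V2 VN.
rewrite (eq_big_nat _ _ (F2 := fun=> 3)).
  have b0 := onea2_neq0 a.
  rewrite mulf_neq0//; last first.
    by rewrite prodf_seq_neq0; apply/allP => i _; rewrite /= pnatr_eq0.
  rewrite (_ : 1 * _ = - 9 * (1 + a ^+ 2)); last by ring.
  by rewrite mulf_neq0// oppr_eq0 pnatr_eq0.
move=> k /andP[k2 kn]; rewrite !psum_gen ?k2 ?(ltnW kn)// !pE E2 V2 /vgen.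
rewrite (ltn_eqF (_ : k.+1 < n.+1)%N)// (gtn_eqF (_ : 2 < k.+1)%N)//.
by ring.
Qed.

(** A nonzero p has fewer than [size p] roots, while e/2, e/3, ... supply [size p] distinct points
    inside the ball of radius e. *)
Lemma near0_nonroot (p : {poly R}) (A : set R) : p != 0 -> nbhs 0 A ->
  exists2 t, A t & p.[t] != 0.
Proof.
move=> p0 /nbhs_ballP[e /= e0 eA]; apply: contrapT => noroot.
pose s := [seq e / (i.+2)%:R | i <- iota 0 (size p)].
have us : uniq s.
  rewrite map_inj_uniq ?iota_uniq// => i j /(mulfI (lt0r_neq0 e0))/invr_inj/eqP.
  by rewrite eqr_nat => /eqP[].
have rs : all (root p) s.
  apply/allP => _ /mapP[i _ ->]; apply/rootP/eqP; apply: contra_notT noroot => pt.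
  exists (e / i.+2%:R) => //; apply: eA; rewrite /ball/= sub0r normrN.
  rewrite gtr0_norm ?divr_gt0 ?ltr0n// ltr_pdivrMr ?ltr0n//.
  by rewrite ltr_pMr// ltr1n.
by have := max_poly_roots p0 rs us; rewrite size_map size_iota ltnn.
Qed.

Definition genericity x : R := gpoly n (1 + a ^+ 2) (co x.1) (co x.2).

Lemma genericity_generic x : genericity x != 0 -> generic a x.
Proof.
rewrite /genericity /gpoly !mulf_eq0 !negb_or -andbA => /and3P[z0 D0 C0]; split=> //.
  apply: contraNneq D0 => D0; apply/eqP.
  transitivity ((1 + a ^+ 2) * (cdot n x.1 x.1 * co x.2 1 * co x.2 n.+1 -
   cdot n x.1 x.2 * (co x.1 n.+1 * co x.2 1 - angmom 1 x.1 x.2 / (1 + a ^+ 2)))).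
    by rewrite /psum -!/(cdot _ _ _) /angmom; field; rewrite onea2_neq0.
  by rewrite D0 mulr0.
move=> k kn; move: C0; rewrite prodf_seq_neq0 => /allP/(_ k).
by rewrite mem_index_iota kn => /(_ isT).
Qed.

Lemma continuous_genericity : continuous genericity.
Proof.
suff C : Ck 0 setT genericity by move=> x; exact: C.
have oT : open [set: V * V] by exact: openT.
have c1 := Ck_co1 0 [set: V * V]; have c2 := Ck_co2 0 [set: V * V].
have ps11 k : Ck 0 [set: V * V] (fun x => psum k (co x.1) (co x.1)).
  by apply: Ck_sum => // i; apply: Ck_mul.
have ps12 k : Ck 0 [set: V * V] (fun x => psum k (co x.1) (co x.2)).
  by apply: Ck_sum => // i; apply: Ck_mul.
apply: Ck_mul => //.
  apply: Ck_mul => //; apply: Ck_add => //.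
    apply: Ck_mul => //; first exact: Ck_cst.
    apply: Ck_add => //; first by do 2!apply: Ck_mul => //.
    by apply: Ck_opp => //; do 2!apply: Ck_mul => //.
  apply: Ck_mul => //; apply: Ck_add => //; first exact: Ck_mul.
  by apply: Ck_opp => //; exact: Ck_mul.
have prodC (r : seq nat) (F : nat -> V * V -> R) : (forall k, Ck 0 setT (F k)) ->
    Ck 0 [set: V * V] (fun x => \prod_(k <- r) F k x).
  move=> CF; elim: r => [|k r IH].
    by apply: Ck_eq (Ck_cst 0 setT 1) => // x _; rewrite big_nil.
  by apply: Ck_eq (Ck_mul oT (CF k) IH) => // x _; rewrite big_cons.
apply: prodC => k; apply: Ck_add => //; first exact: Ck_mul.
by apply: Ck_opp => //; exact: Ck_mul.
Qed.

(** The pivot for k = 2 forces q_2 <> 0, whereas the Kepler centers have q_2 = 0; q_(n+1) <> 0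
    excludes the equator. *)
Lemma generic_regular x : dot x.1 x.1 = 1 -> generic a x -> regular S x.1.
Proof.
move=> q1 [z0 _ /(_ 2%N)]; rewrite hn => /(_ isT) C2; split=> //=.
have noZ b : ~ (x.1 = Z1 n b \/ x.1 = - Z1 n b).
  have [_ _ Zi] := co_Z1 n2 b.
  move=> xZ; suff co0 i : (2 <= i <= n)%N -> co x.1 i = 0.
    by move: C2; rewrite /cdot !big_nat1 !(co0 2%N)// !mul0r subrr eqxx.
  by move=> /Zi e; case: xZ => ->; rewrite ?coN e ?oppr0.
case=> [[][_]|[_]]; [exact: noZ|exact: noZ|].
by rewrite dot_Z0// => /eqP; rewrite oppr_eq0 (negPf z0).
Qed.

Lemma phase_space_closure :
  phase_space S `<=` closure ([set x | genericity x != 0] `&` phase_space S).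
Proof.
move=> [q v] [[/= q1 _] qv] A xA.
have {}q1 : dot q q = 1 by []. have {}qv : dot q v = 0 by [].
pose dq := vec qgen - q; pose dv := vec vgen - v.
pose u (t : R) : V := q + t *: dq.
pose w (t : R) : V := v + t *: dv.
(* The line leaves TS^n; its points are brought back by normalising u and projecting w orthogonally
   to u. *)
pose y t : V * V := ((enorm (u t))^-1 *: u t,
  w t - (dot (u t) (w t) / dot (u t) (u t)) *: u t).
have y0 : y 0 = (q, v).
  rewrite /y /u /w !scale0r !addr0 qv mul0r scale0r subr0.
  by rewrite /enorm q1 sqrtr1 invr1 scale1r.
have cu : continuous u.
  move=> t; apply: cvgD; first exact: cvg_cst.
  exact: scalel_continuous.
have cw : continuous w.
  move=> t; apply: cvgD; first exact: cvg_cst.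
  exact: scalel_continuous.
have cdot12 : continuous (fun t => dot (u t) (w t)).
  move=> t; apply: (@continuous_comp _ _ _ (fun t => (u t, w t)) (fun x => dot x.1 x.2)).
    exact: (cvg_pair (cu t) (cw t)).
  by apply: differentiable_continuous; have [] := is_diff_dot12 (u t, w t).
have cdot11 : continuous (fun t => dot (u t) (u t)).
  move=> t; apply: (@continuous_comp _ _ _ u (fun z : V => dot z z)); first exact: cu.
  by apply: differentiable_continuous; have [] := is_diff_dot1 (u t).
have u0 : u 0 = q by rewrite /u scale0r addr0.
have cy : y t @[t --> 0] --> y 0.
  apply: (@cvg_pair _ _ _ _ (nbhs (y 0).1) (nbhs (y 0).2)).
    apply: cvgZ; last exact: cu.
    apply: cvgV; first by rewrite u0 /enorm q1 sqrtr1 oner_eq0.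
    apply: (@continuous_comp _ _ _ (fun t => dot (u t) (u t)) Num.sqrt).
      exact: cdot11.
    exact: sqrt_continuous.
  apply: cvgB; first exact: cw.
  apply: cvgZ; last exact: cu.
  apply: cvgM; first exact: cdot12.
  by apply: cvgV; [rewrite u0 q1 oner_eq0|exact: cdot11].
have yA : nbhs (0 : R) (y @^-1` A) by apply: cy; rewrite y0.
pose pq i : {poly R} := (co q i)%:P + 'X * (co dq i)%:P.
pose pv i : {poly R} := (co v i)%:P + 'X * (co dv i)%:P.
pose p : {poly R} := gpoly n (1 + a ^+ 2)%:P pq (pproj n pq pv).
have pE t : p.[t] = gpoly n (1 + a ^+ 2) (co (u t)) (pproj n (co (u t)) (co (w t))).
  have cqE : horner_eval t \o pq = co (u t).
    by apply/funext => i; rewrite /= /horner_eval !hornerE /u coD coZ.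
  have cvE : horner_eval t \o pv = co (w t).
    by apply/funext => i; rewrite /= /horner_eval !hornerE /w coD coZ.
  rewrite -[LHS]/(horner_eval t p) rmorph_gpoly cqE.
  congr gpoly; first by rewrite /= /horner_eval hornerC.
  by apply/funext => i; rewrite -cqE -cvE -rmorph_pproj.
(* At t = 1 the line reaches the generic point. *)
have p0 : p != 0.
  apply: contraTneq gpoly_gen_neq0 => p0; rewrite negbK; apply/eqP.
  have := pE 1; rewrite p0 horner0 /u /w !scale1r [q + _]addrC [v + _]addrC !subrK => ->.
  have cq i : (0 < i <= n.+1)%N -> co (vec qgen : V) i = qgen i by exact: co_vec.
  have cv i : (0 < i <= n.+1)%N -> co (vec vgen : V) i = vgen i by exact: co_vec.
  have cp i : (0 < i <= n.+1)%N ->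
      pproj n (co (vec qgen : V)) (co (vec vgen : V)) i = pproj n qgen vgen i.
    move=> iN; rewrite /pproj cq// cv//; congr (_ * _ - _ * _);
      by apply: eq_big_nat => j jN; rewrite !cq// cv.
  by apply/esym/gpoly_ext => //; exact: ltnW n2.
have [t yAt pt] := near0_nonroot p0 yA.
(* The factor q_(n+1) of [gpoly] also excludes u t = 0, where the normalisation would fail. *)
rewrite pE in pt; have ut0 : u t != 0.
  apply: contraNneq pt => ->; rewrite /gpoly co0 !mul0r//.
have e0 := enorm_gt0 ut0; have d0 : dot (u t) (u t) != 0 by rewrite gt_eqF ?dot_gt0.
have yS : dot (y t).1 (y t).1 = 1.
  rewrite /y; move: (u t) e0 => z e0; rewrite /= dotZl dotZr -sqr_enorm; field.
  by rewrite gt_eqF.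
have yT : dot (y t).1 (y t).2 = 0.
  rewrite /y; move: (u t) (w t) e0 d0 => z z' e0 d0.
  by rewrite /= dotZl dotDr dotNr dotZr; field; rewrite d0 gt_eqF.
have gy : genericity (y t) != 0.
  rewrite /genericity.
  have -> : co (y t).1 = (fun i => (enorm (u t))^-1 * co (u t) i).
    by apply/funext => i; rewrite coZ.
  have -> : co (y t).2 = (fun i => (dot (u t) (u t))^-1 *
      pproj n (co (u t)) (co (w t)) i).
    rewrite /y; move: (u t) (w t) d0 => z z' d0.
    apply/funext => i; rewrite /pproj -!dot_sum coB coZ; field.
    by rewrite d0.
  rewrite gpoly_scale mulf_neq0//.
  have ei : (enorm (u t))^-1 != 0 by rewrite invr_eq0 gt_eqF.
  have di : (dot (u t) (u t))^-1 != 0 by rewrite invr_eq0.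
  rewrite !mulf_neq0 ?expf_neq0// prodf_seq_neq0; apply/allP => i _.
  by rewrite /= mulf_neq0 ?expf_neq0.
exists (y t); split=> //; split=> //; split=> //.
exact: generic_regular (genericity_generic gy).
Qed.

Lemma integrals_independent :
  functionally_independent S (lagrange_integrals a hm1 hm2 f).
Proof.
exists [set x | genericity x != 0]; split.
- apply: (@open_comp _ _ genericity [set z | z != 0]); last exact: open_neq.
  by move=> x _; exact: continuous_genericity.
- exact: phase_space_closure.
- by move=> x gx Sx; apply: generic_independent => //; exact: genericity_generic.
Qed.

End Density.

Lemma is_diff_derive (R : realType) (g dg : R -> R) t :
  is_diff t g dg -> is_derive t 1 g (dg 1).
Proof.
move=> [d e]; apply: DeriveDef; first exact/derivable1_diffP.
by rewrite deriveE// e.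
Qed.

(** * Walls and reflections *)

Section Cones.
Context {R : realType} {n : nat}.
Notation V := 'rV[R]_n.+1.
Implicit Types (mu : nat -> R) (q u v w : V).

Definition diag mu u : V := vec (fun i => mu i * co u i).

Lemma diagD mu u v : diag mu (u + v) = diag mu u + diag mu v.
Proof. by apply: coP => i iN; rewrite coD !co_vec// coD mulrDr. Qed.
Lemma diagN mu u : diag mu (- u) = - diag mu u.
Proof. by apply: coP => i iN; rewrite coN !co_vec// coN mulrN. Qed.
Lemma diagZ mu c u : diag mu (c *: u) = c *: diag mu u.
Proof. by apply: coP => i iN; rewrite coZ !co_vec// coZ mulrCA. Qed.
Lemma diag_evec mu i : diag mu (evec i) = mu i *: evec i.
Proof.
by apply: coP => j jN; rewrite coZ !co_vec//; case: eqP => [->//|_]; rewrite !mulr0.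
Qed.
Lemma dot_diag mu u v : dot (diag mu u) v =
  \sum_(1 <= i < n.+2) mu i * (co u i * co v i).
Proof.
by rewrite dot_sum; apply: eq_big_nat => i iN; rewrite co_vec// mulrA.
Qed.
Definition diagE := (diagD, diagN, diagZ, diag_evec).

Lemma is_diff_diag mu q :
  is_diff q (fun y : V => dot (diag mu y) y) (fun w : V => 2 * dot (diag mu q) w).
Proof.
have -> : (fun y : V => dot (diag mu y) y) =
    (fun y => \sum_(1 <= i < n.+2) mu i * (co y i * co y i)).
  by apply/funext => y; rewrite dot_diag.
have H i : is_diff q (fun y : V => mu i * (co y i * co y i))
    (fun w : V => mu i * (co q i * co w i + co q i * co w i)).
  by apply: is_diff_scale; exact: is_diff_mul (is_diff_co q i) (is_diff_co q i).
apply: is_diff_ext (is_diff_bigsum _ H) _ => w.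
by rewrite dot_diag mulr_sumr; apply: eq_bigr => i _; ring.
Qed.

Lemma wall_tangent_eq0 (B : set V) (G dG : V -> R) k q w :
  (forall y, B y -> G y = k) -> is_diff q G dG -> wall_tangent B q w -> dG w = 0.
Proof.
move=> BG Gd [c [c0 cB cd cw]].
have cd' : is_diff 0 c ( *:%R^~ w) by rewrite -cw; exact: is_diff_curve.
rewrite -c0 in Gd.
have [d e] := is_diff_comp cd' Gd.
have -> : dG w = 'D_1 (G \o c) 0 by rewrite deriveE// e/= scale1r.
rewrite -[RHS](derive_cst k (0 : R) 1); apply: near_eq_derive.
by apply: filterS cB => t; exact: BG.
Qed.

Lemma derive1_co (c : R -> V) (t : R) w :
  (forall l, (0 < l <= n.+1)%N -> is_derive t (1 : R) (fun s => co (c s) l) (co w l)) ->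
  derivable c t 1 /\ derive1 c t = w.
Proof.
move=> cw; have cij i j : (fun s => c s i j) = (fun s => co (c s) j.+1).
  apply/funext => s; rewrite /co ord1/=; congr (c s _ _).
  by apply/val_inj; rewrite /= inordK.
have d : derivable c t 1.
  by apply/derivable_mxP => i j; rewrite cij; have [] := cw j.+1 (ltn_ord j).
split=> //; rewrite derive1E derive_mx//; apply: coP => l lN.
by have [_ <-] := cw l lN; rewrite {1}/co mxE.
Qed.

(** Cones are invariant under scaling, so a curve on a cone can be moved to the sphere without
    leaving the cone; its velocity loses the radial part. *)
Lemma normalized_curve (c : R -> V) q w : c 0 = q -> dot q q = 1 ->
  is_diff 0 c ( *:%R^~ w) ->
  let c' t := (enorm (c t))^-1 *: c t in
  [/\ c' 0 = q, \forall t \near 0, dot (c' t) (c' t) = 1,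
      derivable c' 0 1 & derive1 c' 0 = w - dot q w *: q].
Proof.
move=> c0 q1 cd c'.
have c'0 : c' 0 = q by rewrite /c' c0 /enorm q1 sqrtr1 invr1 scale1r.
have dd : is_diff 0 (fun t => dot (c t) (c t)) (fun h => 2 * dot q (h *: w)).
  have gd : is_diff (c 0) (fun y : V => dot y y) (fun w : V => 2 * dot q w).
    by rewrite c0; exact: is_diff_dot1.
  exact: is_diff_comp cd gd.
have cdot0 : dot (c 0) (c 0) = 1 by rewrite c0.
have pos : \forall t \near 0, 0 < dot (c t) (c t).
  have cont : (fun t => dot (c t) (c t)) @ 0 --> dot (c 0) (c 0).
    by have [d _] := dd; exact: (differentiable_continuous d).
  by apply: cvgr_gt cont _ _; rewrite cdot0.
suff [d' e'] : derivable c' 0 1 /\ derive1 c' 0 = w - dot q w *: q.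
  split=> //; apply: filterS pos => t ct0; rewrite /c' dotZl dotZr -sqr_enorm.
  by field; rewrite gt_eqF ?sqrtr_gt0.
apply: derive1_co => l lN.
have -> : (fun s => co (c' s) l) = (fun s => (enorm (c s))^-1 * co (c s) l).
  by apply/funext => s; rewrite coZ.
have s1 : Num.sqrt (dot (c 0) (c 0)) = 1 by rewrite cdot0 sqrtr1.
have ed : is_diff 0 (fun t => (enorm (c t))^-1) (fun h => - dot q (h *: w)).
  have D0 : 0 < dot (c 0) (c 0) by rewrite cdot0.
  have S0 : Num.sqrt (dot (c 0) (c 0)) != 0 by rewrite s1 oner_eq0.
  apply: is_diff_ext (is_diff_inv (is_diff_sqrt dd D0) S0) _ => h.
  by rewrite s1; field.
have gd : is_diff (c 0) (fun y => co y l) (fun y => co y l) by exact: is_diff_co.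
have := is_diff_derive (is_diff_mul ed (is_diff_comp cd gd)).
congr (is_derive _ _ _ _).
by rewrite /= /enorm s1 c0 !scale1r invr1 mul1r coB coZ mulrN [co q l * _]mulrC.
Qed.

(* Cayley parametrisation of the one-parameter group preserving
   mu_i x_i^2 + mu_j x_j^2, up to the factor 1 + mu_i mu_j t^2. *)
Definition cone_curve mu q i j (t : R) : V :=
  q + t *: (2 *: ((mu j * co q j) *: evec i - (mu i * co q i) *: evec j))
  + t ^+ 2 *: ((mu i * mu j) *:
      (q - 2 *: (co q i *: evec i + co q j *: evec j))).

(** Along the curve the form is multiplied by (1 + mu_i mu_j t^2)^2. The polynomial parametrisation
    treats circular and hyperbolic rotations, that is both signs of mu_i mu_j, together. *)
Lemma cone_curve_cone mu q i j t : i != j ->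
  (0 < i <= n.+1)%N -> (0 < j <= n.+1)%N -> dot (diag mu q) q = 0 ->
  dot (diag mu (cone_curve mu q i j t)) (cone_curve mu q i j t) = 0.
Proof.
move=> ij iN jN q0.
have eii k : (0 < k <= n.+1)%N -> dot (evec k : V) (evec k) = 1.
  by move=> kN; rewrite dot_evec// co_evec// eqxx.
have eij : dot (evec i : V) (evec j) = 0.
  by rewrite dot_evec// co_evec// eq_sym (negPf ij).
have eji : dot (evec j : V) (evec i) = 0 by rewrite dotC.
have eq k : (0 < k <= n.+1)%N -> dot (evec k) q = co q k.
  by move=> kN; rewrite dotC dot_evec.
have dq k : (0 < k <= n.+1)%N -> dot (diag mu q) (evec k) = mu k * co q k.
  by move=> kN; rewrite dot_evec// co_vec.
rewrite /cone_curve !diagE !dotE q0 !eii// eij eji !eq// !dq//.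
by ring.
Qed.

Lemma is_diff_cone_curve mu q i j : is_diff 0 (cone_curve mu q i j)
  ( *:%R^~ (2 *: ((mu j * co q j) *: evec i - (mu i * co q i) *: evec j))).
Proof.
rewrite /cone_curve; set Y := 2 *: _; set Z := _ *: (q - _).
have d2 : is_diff 0 (fun t : R => t ^+ 2 *: Z) (fun=> 0).
  have sd : is_diff (0 : R) (fun t : R => t ^+ 2) (fun=> 0).
    by apply: is_diff_ext (is_diff_sqr (is_diff_id (0 : R))) _ => h; rewrite mulr0 mul0r.
  have [d e] := sd; split; first exact: differentiableZl.
  by rewrite diffZl// e; apply/funext => h; rewrite scale0r.
have d1 : is_diff 0 (fun t : R => q + t *: Y) ( *:%R^~ Y).
  have := is_diffD (is_diff_cst q (0 : R)) (is_diff_scalel 0 Y).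
  by congr (is_diff_def); apply/funext => h; rewrite /= fctE add0r.
have [d e] := is_diffD d1 d2; split; first exact: d.
by rewrite e; apply/funext => h; rewrite fctE addr0.
Qed.

End Cones.

(** * From sums and differences of angles to an equation between cosines *)

Section Trigonometry.
Context {R : realType}.
Implicit Types s t c d : R.

Lemma cosDpiB t : cos (pi - t) = - cos t.
Proof. by rewrite cosB cospi sinpi mul0r addr0 mulN1r. Qed.

Lemma cos2piB t : cos (pi + pi - t) = cos t.
Proof. by rewrite -addrA addrC cosDpi cosDpiB opprK. Qed.

Lemma cos_sum_gt0 s t : 0 <= s <= pi -> 0 <= t <= pi ->
  (0 < cos s + cos t) = (s + t < pi).
Proof.
move=> /andP[s0 s1] /andP[t0 t1]; rewrite -[cos t]opprK -cosDpiB subr_gt0.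
by rewrite ltr_cos ?in_itv/= ?s0 ?subr_ge0 ?t1 ?gerBl// ltrBrDr.
Qed.

Lemma cos_sum_lt0 s t : 0 <= s <= pi -> 0 <= t <= pi ->
  (cos s + cos t < 0) = (pi < s + t).
Proof.
move=> /andP[s0 s1] /andP[t0 t1]; rewrite -[cos t]opprK -cosDpiB subr_lt0.
by rewrite ltr_cos ?in_itv/= ?s0 ?subr_ge0 ?t1 ?gerBl// ltrBlDr.
Qed.

(** The number d, later the cosine of the distance of the foci, keeps the difference factor from
    vanishing. As cos c does not tell c from 2 pi - c, the sign of cos s + cos t decides on which
    side of pi the sum lies. *)
Lemma cos_sumP s t d c : 0 <= s <= pi -> 0 <= t <= pi -> 0 < c < 2 * pi -> c <> pi ->
  d <= cos (s - t) -> cos c < d ->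
  s + t = c <->
  (cos (s + t) - cos c) * (cos (s - t) - cos c) = 0 /\
  0 < (pi - c) * (cos s + cos t).
Proof.
move=> sI tI /andP[c0 c2] cpi dD cd; split.
  move=> stc; rewrite stc subrr mul0r; split=> //.
  have [lt|gt|//] := ltgtP c pi.
    by rewrite mulr_gt0 ?subr_gt0// cos_sum_gt0// stc.
  by rewrite nmulr_rgt0 ?subr_lt0// cos_sum_lt0// stc.
case=> /eqP; rewrite mulf_eq0 !subr_eq0 => /orP[]/eqP E; last first.
  by move: cd; rewrite -E ltNge dD.
have /andP[s0 s1] := sI; have /andP[t0 t1] := tI.
have [lt|gt|//] := ltgtP c pi => H.
  apply: cos_inj => //; rewrite in_itv/= ?(ltW c0) ?(ltW lt)// addr_ge0//=.
  by move: H; rewrite pmulr_rgt0 ?subr_gt0// cos_sum_gt0// => /ltW.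
have {}H : pi < s + t by move: H; rewrite nmulr_rgt0 ?subr_lt0// cos_sum_lt0.
apply: oppr_inj; apply: (addrI (pi + pi)); apply: cos_inj; rewrite ?cos2piB//.
  by rewrite in_itv/=; apply/andP; split; lra.
by rewrite in_itv/=; apply/andP; split; lra.
Qed.

Lemma cos_diffP s t d c : 0 <= s <= pi -> 0 <= t <= pi -> 0 < c <= pi ->
  cos (s + t) <= d -> d < cos c ->
  `|s - t| = c <-> (cos (s + t) - cos c) * (cos (s - t) - cos c) = 0.
Proof.
move=> /andP[s0 s1] /andP[t0 t1] /andP[c0 c1] dD cd; split.
  by move=> <-; rewrite cos_norm subrr mulr0.
move=> /eqP; rewrite mulf_eq0 !subr_eq0 => /orP[]/eqP E.
  by move: cd; rewrite -E ltNge dD.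
apply: cos_inj; rewrite ?cos_norm// in_itv/= ?(ltW c0)// normr_ge0/=.
by rewrite ler_norml; apply/andP; split; lra.
Qed.

Lemma cos_sum_diff s t c :
  (cos (s + t) - c) * (cos (s - t) - c)
  = cos s ^+ 2 + cos t ^+ 2 - 2 * c * cos s * cos t - (1 - c ^+ 2).
Proof.
rewrite cosD cosB.
transitivity ((cos s * cos t - c) ^+ 2 - sin s ^+ 2 * sin t ^+ 2); first by ring.
by rewrite !sin2cos2; ring.
Qed.

End Trigonometry.

(** * Confocal quadrics as traces of cones *)

Section Quadrics.
Context {R : realType} {n : nat} (a : R).
Notation V := 'rV[R]_n.+1.
Context (hn : (2 <= n)%N).
Implicit Types (q u v w : V) (C : R).

Let n0 : (0 < n)%N. Proof. exact: ltnW. Qed.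

(* cos d, where d is the distance of the foci *)
Definition cosfoci : R := (1 - a ^+ 2) / (1 + a ^+ 2).

(* The confocal quadric of parameter C = cos c is the trace on the sphere of the
   cone \sum_i qmu C i * q_i ^+ 2 = 0. *)
Definition qmu C (i : nat) : R :=
  if i == 1%N then (1 + C) * (C - cosfoci)
  else if i == n.+1 then (1 - C) * (cosfoci - C)
  else - (1 - C ^+ 2).

Lemma dot_qmu C u v : dot (diag (qmu C) u) v
  = (1 + C) * (C - cosfoci) * (co u 1 * co v 1) - (1 - C ^+ 2) * cdot n u v
    + (1 - C) * (cosfoci - C) * (co u n.+1 * co v n.+1).
Proof.
rewrite dot_cdot// !co_vec ?leqnn//= /qmu eqxx eqSS eqn0Ngt n0/= eqxx.
rewrite !mulrA; congr (_ + _ + _).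
rewrite /cdot mulr_sumr -sumrN; apply: eq_big_nat => i /andP[i2 iN].
rewrite co_vec; last by rewrite (ltnW i2) ltnW.
by rewrite (gtn_eqF i2) ltn_eqF// -mulrA mulNr.
Qed.

(** The foci are mirror images under q_1 |-> - q_1, so the terms in q_1 q_(n+1) cancel; the
    coefficients [qmu] are read off this expansion. *)
Lemma qmu_foci C q : dot (diag (qmu C) q) q
  = dot q (Z1 n a) ^+ 2 + dot q (Z2 n a) ^+ 2
    - 2 * C * dot q (Z1 n a) * dot q (Z2 n a) - (1 - C ^+ 2) * dot q q.
Proof.
rewrite dot_qmu Z2E !dot_Z1// sqrrN dot_cdot// /cosfoci.
have a0 := onea2_neq0 a; have s0 := sqrt_onea2_neq0 a; have s2 := sqr_sqrt_onea2 a.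
set s := Num.sqrt _ in s0 s2 *.
transitivity (((a * co q 1 - co q n.+1) ^+ 2 + (- a * co q 1 - co q n.+1) ^+ 2
  - 2 * C * (a * co q 1 - co q n.+1) * (- a * co q 1 - co q n.+1)) / s ^+ 2
  - (1 - C ^+ 2) * (co q 1 * co q 1 + cdot n q q + co q n.+1 * co q n.+1)).
  by rewrite s2; field.
by field.
Qed.

Lemma dot_foci : dot (Z1 n a) (Z2 n a) = cosfoci.
Proof.
rewrite Z2E dot_Z1//; have [-> -> _] := co_Z1 hn a; rewrite sqrrN /cosfoci.
have a0 := onea2_neq0 a; have s0 := sqrt_onea2_neq0 a; have s2 := sqr_sqrt_onea2 a.
set s := Num.sqrt _ in s0 s2 *.
transitivity ((1 - a ^+ 2) / s ^+ 2); last by rewrite s2.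
by field.
Qed.

Lemma cosfoci_itv : -1 <= cosfoci <= 1.
Proof.
have a2 := onea2_gt0 a; rewrite /cosfoci ler_pdivrMr// ler_pdivlMr//.
by have := sqr_ge0 a; move: (a ^+ 2) => b b0; apply/andP; split; lra.
Qed.

Lemma angle_foci : angle (Z1 n a) (Z2 n a) = acos cosfoci.
Proof. by rewrite /angle dot_foci Z2E !enorm_Z1// mulr1 divr1. Qed.

Lemma angle_sphere q b : dot q q = 1 -> angle q (Z1 n b) = acos (dot q (Z1 n b)).
Proof. by move=> q1; rewrite angle_Z1// /enorm q1 sqrtr1 divr1. Qed.

Lemma cos_sphere q b : dot q q = 1 -> -1 <= dot q (Z1 n b) <= 1.
Proof.
move=> q1; apply: cos_itv.
by have := kden_ge0 b q; rewrite kden_dot// q1 subr_ge0.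
Qed.

Lemma angle_sphere_itv q b : dot q q = 1 -> 0 <= angle q (Z1 n b) <= pi.
Proof.
by move=> q1; rewrite angle_sphere// acos_ge0 ?acos_lepi ?cos_sphere.
Qed.

Lemma cos_angle q b : dot q q = 1 -> cos (angle q (Z1 n b)) = dot q (Z1 n b).
Proof.
by move=> q1; rewrite angle_sphere// acosK// in_itv/= cos_sphere.
Qed.

(* sg = c - pi selects one of the two spheroids c and 2 pi - c of the same cone;
   sg = 0 leaves the hyperboloid unconstrained. *)
Definition cone_wall C sg : set V :=
  [set q | [/\ dot q q = 1, dot (diag (qmu C) q) q = 0
             & sg <> 0 -> 0 < sg * co q n.+1]].

(** By [gram], only the sum factor can vanish if C < [cosfoci], and only the difference factor if C
    > [cosfoci]. As cos theta_Z1 + cos theta_Z2 is a negative multiple of q_(n+1), the sign of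
    q_(n+1) separates the spheroids c and 2 pi - c. *)
Lemma quadric_cone_wall B : spherical_confocal_quadric a B ->
  exists C sg, [/\ -1 < C < 1, C != cosfoci & B = cone_wall C sg].
Proof.
have quad C q : dot q q = 1 ->
    (cos (angle q (Z1 n a) + angle q (Z2 n a)) - C)
    * (cos (angle q (Z1 n a) - angle q (Z2 n a)) - C) = dot (diag (qmu C) q) q.
  by move=> q1; rewrite cos_sum_diff Z2E !cos_angle// qmu_foci Z2E q1 mulr1.
(* The Gram determinant of Z1, Z2 and q is nonnegative. *)
have gram q : dot q q = 1 ->
    cos (angle q (Z1 n a) + angle q (Z2 n a)) <= cosfoci
    <= cos (angle q (Z1 n a) - angle q (Z2 n a)).
  move=> q1; have := quad cosfoci q q1; rewrite dot_qmu !subrr !mulr0 !mul0r add0r addr0.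
  have AD : cos (angle q (Z1 n a) + angle q (Z2 n a)) <=
      cos (angle q (Z1 n a) - angle q (Z2 n a)).
    rewrite cosD cosB lerD2l lerNl.
    have sge b : 0 <= sin (angle q (Z1 n b)).
      by rewrite sin_ge0_pi// angle_sphere_itv.
    by rewrite (le_trans (_ : _ <= 0)) ?oppr_le0 ?mulr_ge0// Z2E.
  have r0 := cdot_ge0 n q; have /andP[dl1 dl2] := cosfoci_itv.
  have : 0 <= (1 - cosfoci ^+ 2) * cdot n q q by rewrite mulr_ge0//; nra.
  move: AD; move: (cos _) (cos _) (_ * _) => A D z AD z0 E.
  by apply/andP; split; rewrite leNgt; apply/negP => H; nra.
case=> c [[]|[]].
  rewrite angle_foci => /andP[dc c2] [cpi ->]; exists (cos c), (c - pi).
  have pi0 := @pi_gt0 R; have d0 := acos_ge0 cosfoci_itv.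
  have dpi := acos_lepi cosfoci_itv.
  have Ed : cos (acos cosfoci) = cosfoci by rewrite acosK// in_itv/= cosfoci_itv.
  have cI : 0 < c < 2 * pi by apply/andP; split; lra.
  have Cd : cos c < cosfoci.
    rewrite -Ed; have [lt|gt|//] := ltgtP c pi.
      by rewrite ltr_cos ?in_itv/= ?d0 ?dpi ?(ltW lt) ?andbT//; lra.
    rewrite -cos2piB ltr_cos ?in_itv/= ?d0 ?dpi//; first lra.
    by apply/andP; split; lra.
  (* c <> pi excludes C = - 1, where the cone degenerates to the hyperplane q_(n+1) = 0. *)
  have C1 : -1 < cos c.
    rewrite lt_def cos_geN1 andbT -cospi; apply/eqP.
    have [lt|gt|//] := ltgtP c pi.
      move=> /cos_inj e; have {}e : c = pi.
        by apply: e; rewrite in_itv/= ?pi_ge0 ?lexx//; apply/andP; split; lra.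
      by lra.
    rewrite -cos2piB => /cos_inj e.
    have {}e : pi + pi - c = pi.
      by apply: e; rewrite in_itv/= ?pi_ge0 ?lexx//; apply/andP; split; lra.
    by lra.
  split; first by rewrite C1 (lt_le_trans Cd)//; have /andP[] := cosfoci_itv.
    by rewrite lt_eqF.
  have s0 : 0 < Num.sqrt (1 + a ^+ 2) by rewrite sqrtr_gt0 onea2_gt0.
  have sg q : dot q q = 1 ->
    (0 < (pi - c) * (cos (angle q (Z1 n a)) + cos (angle q (Z2 n a))))
      = (0 < (c - pi) * co q n.+1).
    move=> q1; rewrite Z2E !cos_angle// !dot_Z1// sqrrN -mulrDl mulrA pmulr_lgt0 ?invr_gt0//.
    rewrite (_ : _ * _ = 2 * ((c - pi) * co q n.+1)); last by ring.
    by rewrite pmulr_rgt0.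
  apply/seteqP; split=> q.
    move=> [/= q1 qc]; have /andP[g1 g2] := gram q q1.
    have := (cos_sumP (angle_sphere_itv a q1) (angle_sphere_itv (- a) q1) cI cpi g2 Cd).1 qc.
    by rewrite quad// sg// => -[].
  case=> /= q1 qQ qs; split=> //; have /andP[g1 g2] := gram q q1.
  apply/(cos_sumP (angle_sphere_itv a q1) (angle_sphere_itv (- a) q1) cI cpi g2 Cd).
  rewrite quad// sg//; split=> //; apply: qs => /eqP.
  by rewrite subr_eq0 => /eqP.
rewrite angle_foci => /andP[c0 cd] ->; exists (cos c), 0.
have pi0 := @pi_gt0 R; have d0 := acos_ge0 cosfoci_itv.
have dpi := acos_lepi cosfoci_itv.
have Ed : cos (acos cosfoci) = cosfoci by rewrite acosK// in_itv/= cosfoci_itv.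
have cI : 0 < c <= pi by rewrite c0 (le_trans (ltW cd)).
have cI' : c \in `[0, pi] by rewrite in_itv/= (ltW c0)/= (le_trans (ltW cd)).
have Cd : cosfoci < cos c.
  by rewrite -Ed ltr_cos// in_itv/= d0.
split.
- have /andP[dl _] := cosfoci_itv; rewrite (le_lt_trans dl)//=.
  by rewrite -cos0 ltr_cos// in_itv/= lexx pi_ge0.
- by rewrite gt_eqF.
apply/seteqP; split=> q.
  move=> [/= q1 qc]; have /andP[g1 g2] := gram q q1; split=> //.
  rewrite -quad//.
  by apply/(cos_diffP (angle_sphere_itv a q1) (angle_sphere_itv (- a) q1) cI g1 Cd).
case=> /= q1 qQ _; split=> //; have /andP[g1 g2] := gram q q1.
by apply/(cos_diffP (angle_sphere_itv a q1) (angle_sphere_itv (- a) q1) cI g1 Cd); rewrite quad.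
Qed.

End Quadrics.

(** * Invariance of the integrals under reflection *)

Section Reflections.
Context {R : realType} {n : nat} (a C sg : R).
Notation V := 'rV[R]_n.+1.
Context (hn : (2 <= n)%N) (C1 : -1 < C < 1) (Ca : C != cosfoci a).
Implicit Types (q u v w : V).
Notation mu := (@qmu R n a C).
Notation B := (@cone_wall R n a C sg).

Let n0 : (0 < n)%N. Proof. exact: ltnW. Qed.

Lemma qmu_neq0 i : mu i != 0.
Proof.
have /andP[Cl Cr] := C1; have p1 : 1 + C != 0 by rewrite gt_eqF; lra.
have m1 : 1 - C != 0 by rewrite gt_eqF; lra.
rewrite /qmu; case: ifP => _; first by rewrite mulf_neq0// subr_eq0.
case: ifP => _; first by rewrite mulf_neq0// subr_eq0 eq_sym.
by rewrite oppr_eq0 (_ : 1 - C ^+ 2 = (1 - C) * (1 + C)) ?mulf_neq0//; ring.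
Qed.

Lemma cone_wall_tangent q w : wall_tangent B q w ->
  dot q w = 0 /\ dot (diag mu q) w = 0.
Proof.
move=> wB; split; apply: (@mulfI _ 2); rewrite ?pnatr_eq0// mulr0.
  apply: (wall_tangent_eq0 (B := B) (G := fun y => dot y y) (k := 1)
    _ (is_diff_dot1 q) wB).
  by move=> y [].
apply: (wall_tangent_eq0 (B := B) (G := fun y => dot (diag mu y) y) (k := 0)
  _ (is_diff_diag mu q) wB).
by move=> y [].
Qed.

Lemma cone_curve_tangent q i j : B q -> i != j ->
  (0 < i <= n.+1)%N -> (0 < j <= n.+1)%N ->
  let Y := 2 *: ((mu j * co q j) *: evec i - (mu i * co q i) *: evec j) in
  wall_tangent B q (Y - dot q Y *: q).
Proof.
move=> [q1 qQ qs] ij iN jN Y.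
have c0 : cone_curve mu q i j 0 = q.
  by rewrite /cone_curve scale0r expr0n/= scale0r !addr0.
have [c'0 c's dc' ec'] := normalized_curve c0 q1 (is_diff_cone_curve mu q i j).
pose c t := (enorm (cone_curve mu q i j t))^-1 *: cone_curve mu q i j t.
have {}c'0 : c 0 = q by exact: c'0.
exists c; split=> //.
(* The sign condition is open, so it persists along the curve near 0. *)
have sgn : sg <> 0 -> \forall t \near 0, 0 < sg * co (c t) n.+1.
  move=> /qs zs; have gd : is_diff (c 0) (fun y : V => sg * co y n.+1)
      (fun y => sg * co y n.+1) by apply: is_diff_scale; exact: is_diff_co.
  have [d _] := is_diff_comp (is_diff_curve dc') gd.
  have cont : (fun t => sg * co (c t) n.+1) @ 0 --> sg * co (c 0) n.+1.
    exact: (differentiable_continuous d).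
  by apply: cvgr_gt cont _ _; rewrite c'0.
have sgn' : \forall t \near 0, sg <> 0 -> 0 < sg * co (c t) n.+1.
  have [->|/eqP s0] := eqVneq sg 0; first by apply: (@filterE _ (nbhs (0 : R))) => t; case.
  by apply: filterS (sgn s0) => t + _.
apply: filterS2 c's sgn' => t ct1 cts; split=> //.
by rewrite /c diagZ dotZl dotZr cone_curve_cone// !mulr0.
Qed.

(** Orthogonality to the curve of the pair i, j says that a 2 by 2 minor of vn and the gradient
    vanishes; the radial correction drops out as vn is tangent to the sphere. The gradient is
    nonzero because q and all [qmu] are. *)
Lemma cone_wall_normal q vn : B q -> tangent q vn ->
  (forall w, wall_tangent B q w -> dot vn w = 0) ->
  exists l, forall i, (0 < i <= n.+1)%N -> co vn i = l * (mu i * co q i).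
Proof.
move=> Bq qvn ort; have [q1 _ _] := Bq.
have par i j : (0 < i <= n.+1)%N -> (0 < j <= n.+1)%N ->
    mu j * co q j * co vn i = mu i * co q i * co vn j.
  move=> iN jN; have [->//|ij] := eqVneq i j.
  have := ort _ (cone_curve_tangent Bq ij iN jN).
  rewrite dotDr dotNr [dot vn (_ *: q)]dotZr [dot vn q]dotC (qvn : dot _ _ = 0) mulr0 subr0.
  rewrite dotZr dotDr dotNr !dotZr !dot_evec// => /eqP.
  by rewrite mulf_eq0 pnatr_eq0/= subr_eq0 => /eqP.
have [k kN k0] : exists2 k, (0 < k <= n.+1)%N & co q k != 0.
  apply: contrapT => H; move/eqP: q1; rewrite (_ : q = 0) ?dot0r ?(eq_sym 0) ?oner_eq0//.
  apply: coP => i iN; rewrite co0; apply/eqP; apply: contra_notT H => i0.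
  by exists i.
exists (co vn k / (mu k * co q k)) => i iN.
have g0 : mu k * co q k != 0 by rewrite mulf_neq0// qmu_neq0.
apply: (mulfI g0); rewrite par// mulrACA mulrA mulrA; field.
by move: g0; rewrite mulf_eq0 negb_or => /andP[-> ->].
Qed.

(** [qmu] is constant on 2, ..., n, so vn is parallel to q in these coordinates and drops out of
    each minor. *)
Lemma reflection_C_hat k : (k <= n)%N -> forall q v v', B q -> reflection B q v v' ->
  C_hat k (q, v) = C_hat k (q, v').
Proof.
move=> kn q v v' Bq [vt [vn [_ [qvn ort] -> ->]]].
have [l vnE] := cone_wall_normal Bq qvn ort.
apply: eq_big_nat => j /andP[j2 jk]; apply: eq_big_nat => i /andP[i2 ij].
have jn : (j <= n)%N by exact: leq_trans (jk : (j <= k)%N) kn.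
have in' : (i <= n)%N by exact: leq_trans (ltnW ij) jn.
rewrite /= !coE !vnE ?(ltnW i2) ?(ltnW j2) ?leqW// /qmu.
rewrite (gtn_eqF i2) (gtn_eqF j2) ltn_eqF// ltn_eqF//; congr (_ ^+ 2); ring.
Qed.

(** Only the cross term of vt and vn changes sign. It vanishes by the equation of the cone at q and
    its linearisation on vt. *)
Lemma reflection_kinetic_sp q v v' : B q -> reflection B q v v' ->
  kinetic_sp a (q, v) = kinetic_sp a (q, v').
Proof.
move=> Bq [vt [vn [wvt [qvn ort] -> ->]]]; have [q1 qQ _] := Bq.
have [l vnE] := cone_wall_normal Bq qvn ort.
have [_ Qvt] := cone_wall_tangent wvt.
have am i u u' : angmom i q (u + u') = angmom i q u + angmom i q u'.
  by rewrite /angmom !coE; ring.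
have amN i u : angmom i q (- u) = - angmom i q u.
  by rewrite /angmom !coE; ring.
suff cross : angmom 1 q vt * angmom 1 q vn / (1 + a ^+ 2)
    + \sum_(2 <= i < n.+1) angmom i q vt * angmom i q vn = 0.
  apply/eqP; rewrite -subr_eq0; apply/eqP.
  rewrite -[RHS](mulr0 2) -{1}cross /kinetic_sp/= -mulrBr opprD addrACA -sumrB.
  rewrite [in RHS]mulrDr mulrDr mulr_sumr [in RHS]mulr_sumr; congr (_ + _).
    by rewrite !am !amN; field; rewrite onea2_neq0.
  by apply: eq_bigr => i _; rewrite !am !amN; field.
have /andP[Cl Cr] := C1.
have mu1 : mu 1%N = (1 + C) * (C - cosfoci a) by [].
have muN : mu n.+1 = (1 - C) * (cosfoci a - C) by rewrite /qmu eqSS eqn0Ngt n0 eqxx.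
have am1 : angmom 1 q vn = l * co q n.+1 * (co q 1 * (mu 1%N - mu n.+1)).
  by rewrite /angmom !vnE ?leqnn//; ring.
rewrite (eq_big_nat _ _ (F2 := fun i => angmom i q vt * co q i *
    (l * co q n.+1 * (- (1 - C ^+ 2) - mu n.+1)))); last first.
  move=> i /andP[i2 iN]; rewrite {2}/angmom !vnE ?leqnn ?(ltnW i2) ?leqW// {1}/qmu.
  by rewrite (gtn_eqF i2) ltn_eqF//; ring.
rewrite -mulr_suml sum_angmom am1 mu1 muN /angmom.
move: Qvt qQ; rewrite !dot_qmu//.
set r := cdot n q q; set s := cdot n q vt; set z := co q n.+1.
set x := co q 1; set y := co vt 1; set t := co vt n.+1.
set dl := cosfoci a => T2 T3.
have c0 : 1 - C ^+ 2 != 0.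
  by rewrite (_ : 1 - C ^+ 2 = (1 - C) * (1 + C)); [rewrite mulf_neq0// gt_eqF; lra|ring].
(* The weight of the first coordinate in terms of the focal distance: this ties the kinetic form to
   the confocal family. *)
have dlE : (1 + a ^+ 2)^-1 = (1 + dl) / 2.
  by rewrite /dl /cosfoci; field; rewrite onea2_neq0.
(* After multiplication by 1 - C^2, [T2] and [T3] eliminate s and r. *)
apply: (mulfI c0); rewrite mulr0 dlE.
have {}T2 : (1 - C ^+ 2) * s = (1 + C) * (C - dl) * (x * y) + (1 - C) * (dl - C) * (z * t).
  by apply/eqP; rewrite -subr_eq0 -oppr_eq0; apply/eqP; rewrite -[RHS]T2; ring.
have {}T3 : (1 - C ^+ 2) * r = (1 + C) * (C - dl) * (x * x) + (1 - C) * (dl - C) * (z * z).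
  by apply/eqP; rewrite -subr_eq0 -oppr_eq0; apply/eqP; rewrite -[RHS]T3; ring.
transitivity ((1 - C ^+ 2) * ((z * y - x * t)
    * (l * z * (x * ((1 + C) * (C - dl) - (1 - C) * (dl - C)))) * ((1 + dl) / 2))
  + l * z * (- (1 - C ^+ 2) - (1 - C) * (dl - C))
    * (z * ((1 - C ^+ 2) * s) - ((1 - C ^+ 2) * r) * t)).
  by ring.
by rewrite T2 T3; field.
Qed.

Lemma reflection_E_sp hm1 hm2 f q v v' : B q -> reflection B q v v' ->
  E_sp a hm1 hm2 f (q, v) = E_sp a hm1 hm2 f (q, v').
Proof. by move=> Bq r; rewrite !E_spE (reflection_kinetic_sp Bq r). Qed.

Lemma reflection_E_sph hm1 hm2 f q v v' : reflection B q v v' ->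
  E_sph a hm1 hm2 f (q, v) = E_sph a hm1 hm2 f (q, v').
Proof.
move=> [vt [vn [wvt [qvn ort] -> ->]]]; rewrite !E_sphE/=; congr (_ * _ - _).
by rewrite !dotE [dot vt vn]dotC (ort _ wvt); ring.
Qed.

(** The symmetry at [Z0] changes the signs of q_1, ..., q_n and keeps q_(n+1), which respects a
    diagonal form and the sign condition. *)
Lemma cone_wall_centered : centered_at (Z0 n) B.
Proof.
move=> q [q1 qQ qs]; set q' := _ - _.
have Z0i i : (0 < i <= n.+1)%N -> co (Z0 n : V) i = if i == n.+1 then -1 else 0.
  by case: i => // i iN; rewrite /co mxE inordK.
have cN : co q' n.+1 = co q n.+1.
  by rewrite /q' !coE dot_Z0 Z0i ?leqnn// eqxx; ring.
have cE i : (0 < i <= n)%N -> co q' i = - co q i.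
  move=> /andP[i0 iN]; rewrite /q' !coE Z0i ?i0 ?leqW//.
  by rewrite ltn_eqF// mulr0 add0r.
have sq i : (0 < i <= n.+1)%N -> co q' i * co q' i = co q i * co q i.
  move=> /andP[i0]; rewrite leq_eqVlt => /predU1P[->|iN]; first by rewrite cN.
  by rewrite cE ?mulrNN// i0.
split; last by rewrite cN.
- by rewrite -q1 !dot_sum; apply: eq_big_nat => i iN; rewrite sq.
- by rewrite -qQ !dot_diag; apply: eq_big_nat => i iN; rewrite sq.
Qed.

End Reflections.

(** * Integrability of the Lagrange problem and of its subcases *)

Lemma lagrange_integrable (R : realType) (n : nat) (a hm1 hm2 f : R)
    (m : nat) (B : 'I_m -> set 'rV[R]_n.+1) :
  (3 <= n)%N -> (forall k, spherical_confocal_quadric a (B k)) ->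
  integrable_by (lagrange_problem n a hm1 hm2 f) B (lagrange_integrals a hm1 hm2 f).
Proof.
move=> hn hB; have n2 : (2 <= n)%N by exact: ltnW.
have kn k (i : 'I_n) : val i = k.+2 -> (k.+3 <= n)%N by move=> <-; exact: ltn_ord.
have inv i j x : phase_space (lagrange_problem n a hm1 hm2 f) x ->
    poisson_bracket (lagrange_integrals a hm1 hm2 f i)
      (lagrange_integrals a hm1 hm2 f j) x = 0.
  move=> Sx; rewrite /lagrange_integrals.
  case Ei: (val i) => [|[|k]]; case Ej: (val j) => [|[|l]].
  - exact: bracket_self.
  - exact: bracket_E_sph_E_sp.
  - by rewrite bracketC bracket_C_hat_E_sph ?oppr0// (kn _ j).
  - by rewrite bracketC bracket_E_sph_E_sp ?oppr0.
  - exact: bracket_self.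
  - by rewrite bracketC bracket_C_hat_E_sp ?oppr0// (kn _ j).
  - by rewrite bracket_C_hat_E_sph// (kn _ i).
  - by rewrite bracket_C_hat_E_sp// (kn _ i).
  - by apply: bracket_C_hat Sx => //; [exact: (kn _ i)|exact: (kn _ j)].
have sm i : smooth_near (phase_space (lagrange_problem n a hm1 hm2 f))
    (lagrange_integrals a hm1 hm2 f i).
  rewrite /lagrange_integrals; case: (val i) => [|[|k]];
    [exact: smooth_E_sph|exact: smooth_E_sp|exact: smooth_C_hat].
split.
- exact: smooth_force.
- move=> i; split; first exact: sm.
  apply: (@first_integral_bracket _ _ _ (E_sph a hm1 hm2 f)).
  + move=> x Sx w; have xD := phase_domain n2 Sx.
    have [_ ->] := is_diff_E_sph n2 xD.
    by have [_ ->] := is_diff_force n2 xD.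
  + move=> x Sx; have [A [_ SA /(_ 1%N)[dF _]]] := sm i.
    exact/dF/SA.
  + move=> x Sx; exact: (inv (Ordinal (ltnW n2)) i).
- exact: integrals_independent.
- exact: inv.
- move=> i k q v v' Bq _ r; have [C [sg [C1 Ca BE]]] := quadric_cone_wall n2 (hB k).
  rewrite BE in Bq r; rewrite /lagrange_integrals.
  case Ei: (val i) => [|[|l]].
  + exact: reflection_E_sph r.
  + exact: (reflection_E_sp n2 C1 Ca _ _ _ Bq r).
  + exact: (reflection_C_hat C1 Ca (kn _ i Ei) Bq r).
Qed.

(** With zero weights the extra forces vanish and the guarded singular sets are empty, so each
    subcase equals an instance of the Lagrange problem and integrability transfers by rewriting. *)
Lemma mech_system_eq (R : realType) (n : nat) (S S' : @mech_system R n) :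
  (forall q, force S q = force S' q) ->
  (forall q, singular S q <-> singular S' q) -> S = S'.
Proof.
case: S S' => [F A] [F' A'] /= /funext -> AA'; congr MechSystem.
by apply/funext => q; apply/propext.
Qed.

Theorem theorem6 (R : realType) (n : nat) (a hm1 hm2 f : R)
    (m : nat) (B : 'I_m -> set 'rV[R]_n.+1)
    (hn : (3 <= n)%N) (ha : a <> 0)
    (hB : forall k, spherical_confocal_quadric a (B k)) :
  integrable_by (lagrange_problem n a hm1 hm2 f) B (lagrange_integrals a hm1 hm2 f) /\
  integrable_by (two_center n a hm1 hm2) B (lagrange_integrals a hm1 hm2 0) /\
  integrable_by (kepler (Z1 n a) hm1) B (lagrange_integrals a hm1 0 0) /\
  integrable_by (kepler (Z2 n a) hm2) B (lagrange_integrals a 0 hm2 0) /\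
  (integrable_by (hooke (Z0 n) f) B (lagrange_integrals a 0 0 f) /\
   forall k, centered_at (Z0 n) (B k)).
Proof.
have L h1 h2 h := lagrange_integrable h1 h2 h hn hB.
split; first exact: L.
split.
  rewrite (_ : two_center n a hm1 hm2 = lagrange_problem n a hm1 hm2 0); first exact: L.
  apply: mech_system_eq => q /=; first by rewrite mul0r addr0.
  by tauto.
split.
  rewrite (_ : kepler _ _ = lagrange_problem n a hm1 0 0); first exact: L.
  apply: mech_system_eq => q /=; first by rewrite !mul0r !addr0.
  by tauto.
split.
  rewrite (_ : kepler _ _ = lagrange_problem n a 0 hm2 0); first exact: L.
  apply: mech_system_eq => q /=; first by rewrite !mul0r add0r addr0.
  by tauto.
split.
  rewrite (_ : hooke _ _ = lagrange_problem n a 0 0 f); first exact: L.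
  apply: mech_system_eq => q /=; first by rewrite !mul0r !add0r.
  by tauto.
move=> k; have [C [sg [_ _ ->]]] := quadric_cone_wall (ltnW hn) (hB k).
exact: cone_wall_centered.
Qed.
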